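(* Let $k\ge2$ and let $(f_h^n,\mathbf E_h^n)_{n\ge0}$ be produced by the fully discrete discontinuous Galerkin (DG) method for the Vlasov–Ampère system with time integrator $\textbf{Scheme-1}(\Delta t)$ (defined in the context), with either upwind or central numerical fluxes. Then $TE_n=TE_{n+1}$, where $$2\,TE_n=\int_{\Omega_x}\int_{\Omega_v} f_h^n|\mathbf v|^2\,d\mathbf v\,d\mathbf x+\int_{\Omega_x}|\mathbf E_h^n|^2\,d\mathbf x .$$ The same holds for the DG methods with time integrators $\textbf{Scheme-2}(\Delta t)$ and $\textbf{Scheme-2F}(\Delta t)$. For the DG method with time integrator $\textbf{Scheme-3}(\Delta t)$, $TE_n=TE_{n+1}$ holds with $$2\,TE_n=\int_{\Omega_x}\int_{\Omega_v} f_h^n|\mathbf v|^2\,d\mathbf v\,d\mathbf x+\int_{\Omega_x}\mathbf E_h^{n+1/2}\cdot\mathbf E_h^{n-1/2}\,d\mathbf x=\int_{\Omega_x}\int_{\Omega_v} f_h^n|\mathbf v|^2\,d\mathbf v\,d\mathbf x+\int_{\Omega_x}|\mathbf E_h^n|^2\,d\mathbf x-\frac{\Delta t^2}4\int_{\Omega_x}|\mathbf J_h^n|^2\,d\mathbf x,$$ where $\mathbf J_h^n=\int_{\Omega_v}f_h^n\mathbf v\,d\mathbf v$.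
   Context: The Vlasov–Ampère system is $\partial_t f+\mathbf v\cdot\nabla_{\mathbf x}f+\mathbf E\cdot\nabla_{\mathbf v}f=0$, $\partial_t\mathbf E=-\mathbf J$, $\mathbf J=\int_{\Omega_v}f\mathbf v\,d\mathbf v$, on $\Omega=\Omega_x\times\Omega_v$, where $\Omega_x,\Omega_v\subset\mathbb R^{d}$ are bounded, with periodic boundary conditions in $\mathbf x$. Mesh and space. $\mathcal T_h^x=\{K_x\}$, $\mathcal T_h^v=\{K_v\}$ are partitions of $\Omega_x$, $\Omega_v$ into Cartesian elements or simplices, and $\mathcal T_h=\{K=K_x\times K_v\}$. For an integer $k\ge0$, $$\mathcal G_h^k=\{g\in L^2(\Omega): g|_{K_x\times K_v}\in P^k(K_x\times K_v)\ \ \forall K_x\in\mathcal T_h^x,\,K_v\in\mathcal T_h^v\},$$ with $P^k(D)$ the polynomials of total degree at most $k$ on $D$. On an edge shared by $K_x^+,K_x^-$ with outward unit normals $\mathbf n_x^\pm$ (respectively $K_v^\pm$, $\mathbf n_v^\pm$), with traces $g^\pm$, set $[g]=g^+\mathbf n^++g^-\mathbf n^-$ and $\{g\}=\frac12(g^++g^-)$ (similarly $\{\mathbf U\}=\frac12(\mathbf U^++\mathbf U^-)$), with subscript $x$ or $v$ indicating the variable. Edges in $\mathbf x$ are identified periodically. Numerical fluxes. Upwind: $\widehat{f\mathbf v\cdot\mathbf n_x}=\big(\{f\mathbf v\}_x+\frac{|\mathbf v\cdot\mathbf n_x|}2[f]_x\big)\cdot\mathbf n_x$, $\widehat{f\mathbf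 E\cdot\mathbf n_v}=\big(\{f\mathbf E\}_v+\frac{|\mathbf E\cdot\mathbf n_v|}2[f]_v\big)\cdot\mathbf n_v$. Central: the same without the jump terms. For steps of negative length the upwind flux is replaced by the downwind flux (sign of the jump terms reversed). Standing assumption: $\Omega_v$ is so large that all numerical approximations of $f$ vanish at $\partial\Omega_v$ (traces are zero there, exterior value zero), so all numerical fluxes on $\partial\Omega_v$ vanish. For $K=K_x\times K_v$ put $$B_K(f,\mathbf E;g)=-\int_K f\mathbf v\cdot\nabla_{\mathbf x}g\,d\mathbf x d\mathbf v-\int_K f\mathbf E\cdot\nabla_{\mathbf v}g\,d\mathbf x d\mathbf v+\int_{K_v}\int_{\partial K_x}\widehat{f\mathbf v\cdot\mathbf n_x}\,g\,ds_xd\mathbf v+\int_{K_x}\int_{\partial K_v}\widehat{f\mathbf E\cdot\mathbf n_v}\,g\,ds_vd\mathbf x ,$$ where $\mathbf n_x,\mathbf n_v$ are outward unit normals of $\partial K_x,\partial K_v$, and $\mathbf J_h^m=\int_{\Omega_v}f_h^m\mathbf v\,d\mathbf v$. An initial field $\mathbf E_h^0(\mathbf x)$ (square integrable) and $f_h^0\in\mathcal G_h^k$ are given. In each scheme below all $f_h$'s lie in $\mathcal G_h^k$ and the equations hold for every $K$ and every $g\in\mathcal G_h^k$; for implicit schemes, any sequence satisfying the equations is meant. $\textbf{Scheme-1}(\Delta t)$: $\int_K\frac{f_h^{n+1/2}-f_h^n}{\Delta t/2}g+B_K(f_h^n,\mathbf E_h^n;g)=0$; $\ \frac{\mathbf E_h^{n+1}-\mathbf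 E_h^n}{\Delta t}=-\mathbf J_h^{n+1/2}$; $\ \int_K\frac{f_h^{n+1}-f_h^n}{\Delta t}g+B_K\big(f_h^{n+1/2},\tfrac12(\mathbf E_h^n+\mathbf E_h^{n+1});g\big)=0$. $\textbf{Scheme-2}(\Delta t)$: $\int_K\frac{f_h^{n+1}-f_h^n}{\Delta t}g+B_K\big(\tfrac12(f_h^n+f_h^{n+1}),\tfrac12(\mathbf E_h^n+\mathbf E_h^{n+1});g\big)=0$; $\ \frac{\mathbf E_h^{n+1}-\mathbf E_h^n}{\Delta t}=-\tfrac12(\mathbf J_h^n+\mathbf J_h^{n+1})$. $\textbf{Scheme-3}(\Delta t)$: $\frac{\mathbf E_h^{n+1/2}-\mathbf E_h^n}{\Delta t/2}=-\mathbf J_h^n$; $\ \int_K\frac{f_h^{n+1}-f_h^n}{\Delta t}g+B_K\big(\tfrac12(f_h^n+f_h^{n+1}),\mathbf E_h^{n+1/2};g\big)=0$; $\ \frac{\mathbf E_h^{n+1}-\mathbf E_h^{n+1/2}}{\Delta t/2}=-\mathbf J_h^{n+1}$. Here $\mathbf E_h^{n-1/2}$ is the intermediate field of the preceding step, so $\mathbf E_h^{n-1/2}=\mathbf E_h^n+\frac{\Delta t}2\mathbf J_h^n$; for $n=0$ this formula is the definition. $\textbf{Scheme-2F}(\Delta t)=\textbf{Scheme-2}(\beta_1\Delta t)\,\textbf{Scheme-2}(\beta_2\Delta t)\,\textbf{Scheme-2}(\beta_3\Delta t)$ (composition), with $\beta_1=\beta_3=(2+2^{1/3}+2^{-1/3})/3$,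 $\beta_2=1-2\beta_1<0$. *)

(* Defs.v *)
From HB Require Import structures.
From mathcomp Require Import all_boot all_order all_algebra.
From mathcomp Require Import all_classical all_reals all_analysis.
From mathcomp Require Import measurable_realfun.

Set Implicit Arguments.
Unset Strict Implicit.
Unset Printing Implicit Defensive.

Import Order.TTheory GRing.Theory Num.Theory.
Import numFieldNormedType.Exports.

Local Open Scope classical_set_scope.
Local Open Scope ring_scope.

Definition measure_rV_display : measure_display.
Proof. exact: default_measure_display. Qed.

Section measurable_rV.
Context {R : realType} (n : nat).

Definition rV_coord (i : 'I_n) (x : 'rV[R]_n) : R := x ord0 i.

Let rV_set0 : g_sigma_preimage rV_coord set0.
Proof. exact: sigma_algebra0. Qed.

Let rV_setC A :
  g_sigma_preimage rV_coord A -> g_sigma_preimage rV_coord (~` A).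
Proof. exact: sigma_algebraC. Qed.

Let rV_bigcup (F : (set 'rV[R]_n)^nat) :
  (forall i, g_sigma_preimage rV_coord (F i)) ->
  g_sigma_preimage rV_coord (\bigcup_i (F i)).
Proof. exact: sigma_algebra_bigcup. Qed.

HB.instance Definition _ := @isMeasurable.Build measure_rV_display
  'rV[R]_n (g_sigma_preimage rV_coord) rV_set0 rV_setC rV_bigcup.

Lemma measurable_rV_coord (i : 'I_n) :
  measurable_fun [set: 'rV[R]_n] (rV_coord i).
Proof.
move=> _ Y mY; rewrite setTI; apply: sub_sigma_algebra => /=.
rewrite -bigcup_seq/=; exists i => /=; first by rewrite mem_index_enum.
by exists Y => //; rewrite setTI.
Qed.

Lemma measurable_fun_rV d (T : measurableType d) (f : T -> 'rV[R]_n) :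
  (forall i, measurable_fun setT (fun t => f t ord0 i)) ->
  measurable_fun setT f.
Proof.
move=> mf; apply: (@measurability _ _ _ _ _ _
  (\big[setU/set0]_(i < n) preimage_set_system setT (rV_coord i) measurable)).
  by [].
move=> _ [B + <-].
rewrite -bigcup_seq => -[i _ [C mC <-]]; rewrite !setTI.
by rewrite -[X in measurable X]setTI; exact: mf.
Qed.

End measurable_rV.

(* Lebesgue measure on R^(n+1) is the product of that of R and that of R^n. *)
Section lebesgue_rV_cons.
Context {R : realType} (n : nat).
Variable mu : {sigma_finite_measure set 'rV[R]_n -> \bar R}.

Definition rV_cons (p : measurableTypeR R * 'rV[R]_n) : 'rV[R]_n.+1 :=
  row_mx (p.1 : R)%:M p.2.

Lemma rV_cons0 p : rV_cons p ord0 ord0 = p.1.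
Proof. by rewrite mxE; case: splitP => // k _; rewrite mxE (ord1 k). Qed.

Lemma rV_consS p j : rV_cons p ord0 (lift ord0 j) = p.2 ord0 j.
Proof.
rewrite mxE; case: splitP => k; first by rewrite (ord1 k).
by move=> [/eqP]; rewrite eqn_add2l => /eqP/val_inj ->.
Qed.

Lemma measurable_rV_cons : measurable_fun setT rV_cons.
Proof.
apply: measurable_fun_rV => i.
case: (unliftP ord0 i) => [j|] ->.
  under eq_fun do rewrite rV_consS.
  exact: measurableT_comp (measurable_rV_coord j) measurable_snd.
by under eq_fun do rewrite rV_cons0; exact: measurable_fst.
Qed.

Definition lebesgue_cons : set 'rV[R]_n.+1 -> \bar R :=
  pushforward (lebesgue_measure \x mu)%E rV_cons.

Let lebesgue_cons0 : lebesgue_cons set0 = 0%E.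
Proof. by rewrite /lebesgue_cons /pushforward preimage_set0 measure0. Qed.

Let lebesgue_cons_ge0 A : (0 <= lebesgue_cons A)%E.
Proof. by rewrite /lebesgue_cons /pushforward; exact: measure_ge0. Qed.

Let lebesgue_cons_sigma_additive : semi_sigma_additive lebesgue_cons.
Proof.
move=> F mF tF mUF.
rewrite /lebesgue_cons /pushforward preimage_bigcup.
apply: measure_semi_sigma_additive.
- by move=> k; rewrite -[X in measurable X]setTI; exact: measurable_rV_cons.
- apply/trivIsetP => /= i j _ _ ij; rewrite -preimage_setI.
  by move/trivIsetP : tF => /(_ _ _ _ _ ij) ->//; rewrite preimage_set0.
- rewrite -preimage_bigcup -[X in measurable X]setTI.
  exact: measurable_rV_cons.
Qed.

HB.instance Definition _ := isMeasure.Build _ _ _ lebesgue_cons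
  lebesgue_cons0 lebesgue_cons_ge0 lebesgue_cons_sigma_additive.

Let lebesgue_cons_sigma_finite : sigma_finite setT lebesgue_cons.
Proof.
have /sigma_finiteP[F [TF ndF Foo]] := sigma_finiteT (@lebesgue_measure R).
have /sigma_finiteP[G [TG ndG Goo]] := sigma_finiteT mu.
pose uncons (x : 'rV[R]_n.+1) : measurableTypeR R * 'rV[R]_n :=
  (x ord0 ord0, \row_j x ord0 (lift ord0 j)).
have muncons : measurable_fun setT uncons.
  apply: measurable_fun_pair; first exact: measurable_rV_coord.
  apply: measurable_fun_rV => i.
  by under eq_fun do rewrite mxE; exact: measurable_rV_coord.
have consK : cancel rV_cons uncons.
  move=> [a y]; rewrite /uncons rV_cons0; congr pair.
  by apply/rowP => j; rewrite mxE rV_consS.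
exists (fun k => uncons @^-1` (F k `*` G k)).
  apply/esym; rewrite -subTset => x _.
  have [i _ Fi] : (\bigcup_k F k) (uncons x).1 by rewrite -TF.
  have [j _ Gj] : (\bigcup_k G k) (uncons x).2 by rewrite -TG.
  exists (maxn i j) => //; split.
    by move: Fi; exact/subsetPset/ndF/leq_maxl.
  by move: Gj; exact/subsetPset/ndG/leq_maxr.
move=> k; have [mF ?] := Foo k; have [mG ?] := Goo k; split.
  by rewrite -[X in measurable X]setTI; apply: muncons => //; exact: measurableX.
rewrite /lebesgue_cons /pushforward -comp_preimage.
rewrite (_ : uncons \o rV_cons = id); last by apply/funext => p; exact: consK.
by rewrite preimage_id product_measure1E// lte_mul_pinfty// ge0_fin_numE.
Qed.

HB.instance Definition _ := Measure_isSigmaFinite.Build _ _ _ lebesgue_cons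
  lebesgue_cons_sigma_finite.

End lebesgue_rV_cons.

Fixpoint lebesgue_rV {R : realType} (n : nat) :
    {sigma_finite_measure set 'rV[R]_n -> \bar R} :=
  match n with
  | 0 => \d_(0 : 'rV[R]_0)
  | n'.+1 => lebesgue_cons (lebesgue_rV n')
  end.

Definition dot {R : realType} {n : nat} (u v : 'rV[R]_n) : R :=
  \sum_(i < n) u ord0 i * v ord0 i.

Lemma measurable_dot {R : realType} (n : nat) (u : 'rV[R]_n) :
  measurable_fun setT (dot u).
Proof.
apply: measurable_sum => i; apply: measurable_funM => //.
exact: measurable_rV_coord.
Qed.

(* For a unit vector n, this is the (d-1)-dimensional surface measure on the  *)
(* hyperplane H = {x | dot n x = c}: the area of A `&` H is the volume of the *)
(* right cylinder of height 1 with base A `&` H, which is centered at H so    *)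
(* that (n, c) and (- n, - c) visibly define the same measure.                *)
Section hyperplane_measure.
Context {R : realType} (d : nat) (n : 'rV[R]_d) (c : R).

Definition hyperplane_proj (y : 'rV[R]_d) : 'rV[R]_d := y - (dot n y - c) *: n.

Definition hyperplane_cylinder (A : set 'rV[R]_d) : set 'rV[R]_d :=
  [set y | `|dot n y - c| <= 2^-1] `&` hyperplane_proj @^-1` A.

Lemma measurable_hyperplane_proj : measurable_fun setT hyperplane_proj.
Proof.
apply: measurable_fun_rV => i.
under eq_fun do rewrite !mxE.
apply: measurable_funB; first exact: measurable_rV_coord.
apply: measurable_funM => //; apply: measurable_funB => //.
exact: measurable_dot.
Qed.

Lemma measurable_hyperplane_cylinder (A : set 'rV[R]_d) :
  measurable A -> measurable (hyperplane_cylinder A).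
Proof.
move=> mA; apply: measurableI; last first.
  by rewrite -[X in measurable X]setTI; exact: measurable_hyperplane_proj.
rewrite (_ : [set _ | _] = (fun y => dot n y - c) @^-1` `[- 2^-1, 2^-1]).
  rewrite -[X in measurable X]setTI.
  apply: measurable_funB => //; exact: measurable_dot.
by apply/seteqP; split => y /=; rewrite in_itv /= ler_norml.
Qed.

Definition hyperplane_measure (A : set 'rV[R]_d) : \bar R :=
  lebesgue_rV d (hyperplane_cylinder A).

Let hyperplane_measure0 : hyperplane_measure set0 = 0%E.
Proof.
by rewrite /hyperplane_measure /hyperplane_cylinder preimage_set0 setI0 measure0.
Qed.

Let hyperplane_measure_ge0 A : (0 <= hyperplane_measure A)%E.
Proof. by rewrite /hyperplane_measure measure_ge0. Qed.

Let hyperplane_measure_sigma_additive : semi_sigma_additive hyperplane_measure.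
Proof.
move=> F mF tF mUF.
have cylU : hyperplane_cylinder (\bigcup_k F k) =
    \bigcup_k hyperplane_cylinder (F k).
  by rewrite /hyperplane_cylinder preimage_bigcup setI_bigcupr.
rewrite /hyperplane_measure cylU; apply: measure_semi_sigma_additive.
- by move=> k; exact: measurable_hyperplane_cylinder.
- apply/trivIsetP => /= i j _ _ ij; rewrite setIACA -preimage_setI.
  by move/trivIsetP : tF => /(_ _ _ _ _ ij) ->//; rewrite preimage_set0 setI0.
- by rewrite -cylU; exact: measurable_hyperplane_cylinder.
Qed.

HB.instance Definition _ := isMeasure.Build _ _ _ hyperplane_measure
  hyperplane_measure0 hyperplane_measure_ge0 hyperplane_measure_sigma_additive.

End hyperplane_measure.

Section mesh.
Context {R : realType} {d : nat}.

(* A polytope is given by the outward unit normals n_i of its facets and the  *)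
(* offsets c_i such that the i-th facet lies in {x | dot n_i x = c_i}.        *)
Record polytope := Polytope {
  facets : nat ;
  normal : 'I_facets -> 'rV[R]_d ;
  offset : 'I_facets -> R }.

#[local] Arguments normal : clear implicits.
#[local] Arguments offset : clear implicits.

Definition cell (K : polytope) : set 'rV[R]_d :=
  [set x | forall i, dot (normal K i) x < offset K i].

Definition closed_cell (K : polytope) : set 'rV[R]_d :=
  [set x | forall i, dot (normal K i) x <= offset K i].

Definition facet (K : polytope) (i : 'I_(facets K)) : set 'rV[R]_d :=
  closed_cell K `&` [set x | dot (normal K i) x = offset K i].

Definition unit_normals (K : polytope) : Prop :=
  forall i, dot (normal K i) (normal K i) = 1.

(* A box in R^d has 2d facets and a simplex has d+1 of them. As none of them  *)
(* can be missing in the half-space description, requiring exactly this       *)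
(* number of half-spaces makes normal K a list without repetition of all the  *)
(* outward unit normals.                                                      *)
Definition is_cartesian (K : polytope) : Prop :=
  [/\ facets K = (2 * d)%N, unit_normals K &
    exists a b : 'rV[R]_d, (forall i, a ord0 i < b ord0 i) /\
      closed_cell K = [set x | forall i, a ord0 i <= x ord0 i <= b ord0 i]].

Definition is_simplex (K : polytope) : Prop :=
  [/\ facets K = d.+1, unit_normals K &
    exists p : 'I_d.+1 -> 'rV[R]_d,
      row_free (\matrix_(i < d) (p (lift ord0 i) - p ord0)) /\
      closed_cell K = [set x | exists w : 'I_d.+1 -> R,
        [/\ forall i, 0 <= w i, \sum_i w i = 1 & x = \sum_i w i *: p i]]].

Definition mesh_domain (I : finType) (T : I -> polytope) : set 'rV[R]_d :=
  \bigcup_(K in [set: I]) closed_cell (T K).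

(* Nonconforming partitions (hanging nodes) are allowed. *)
Definition is_mesh (I : finType) (T : I -> polytope) : Prop :=
  (forall K, is_cartesian (T K) \/ is_simplex (T K)) /\
  (forall K K', K != K' -> cell (T K) `&` cell (T K') = set0).

End mesh.

Arguments polytope : clear implicits.
Arguments normal {R d} K i : rename.
Arguments offset {R d} K i : rename.
Arguments facet {R d} K i.

Record phase_mesh (R : realType) (d : nat) := PhaseMesh {
  Ix : finType ;
  Iv : finType ;
  Tx : Ix -> polytope R d ;
  Tv : Iv -> polytope R d ;
  period_basis : 'M[R]_d }.

Section dg.
Context {R : realType} {d : nat} (M : phase_mesh R d).

Local Notation X := 'rV[R]_d.
Local Notation leb := (@lebesgue_rV R d).
Local Notation leb2 := (leb \x leb)%E.

Definition Omega_x : set X := mesh_domain (@Tx _ _ M).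
Definition Omega_v : set X := mesh_domain (@Tv _ _ M).
Definition Omega : set (X * X) := Omega_x `*` Omega_v.

Definition periods : set X :=
  [set map_mx intr m *m period_basis M | m in [set: 'rV[int]_d]].

(* Functions that are periodic in x live on R^d / periods, of which Omega_x   *)
(* has to be a fundamental domain. The usual case of a box corresponds to a   *)
(* diagonal period_basis.                                                     *)
Definition periodic_domain : Prop :=
  [/\ period_basis M \in unitmx,
    forall y, exists2 l, periods l & Omega_x (y - l) &
    forall l, periods l -> l != 0 ->
      Omega_x° `&` [set x | Omega_x° (x - l)] = set0].

Definition is_phase_mesh : Prop :=
  [/\ is_mesh (@Tx _ _ M), is_mesh (@Tv _ _ M) & periodic_domain].

Definition element (K : Ix M) (L : Iv M) : set (X * X) :=
  cell (Tx K) `*` cell (Tv L).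

Definition square_integrable disp (T : measurableType disp)
    (mu : {measure set T -> \bar R}) (D : set T) (g : T -> R) : Prop :=
  measurable_fun D g /\ mu.-integrable D (fun z => (g z ^+ 2)%:E).

Definition polynomial_on (k : nat) (D : set (X * X)) (g : X * X -> R) : Prop :=
  exists c : {ffun 'I_(d + d) -> 'I_k.+1} -> R, forall z, D z ->
    g z = \sum_(a : {ffun 'I_(d + d) -> 'I_k.+1} | (\sum_i a i <= k)%N)
      c a * \prod_i row_mx z.1 z.2 ord0 i ^+ a i.

Definition dg_space (k : nat) (g : X * X -> R) : Prop :=
  square_integrable leb2 Omega g /\
  forall K L, polynomial_on k (element K L) g.

Definition trace (K : Ix M) (L : Iv M) (g : X * X -> R) (z : X * X) : R :=
  lim (g @ within (element K L) (nbhs z)).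

Definition vanishes_at_boundary (g : X * X -> R) : Prop :=
  forall K L x v, closed_cell (Tx K) x -> closed_cell (Tv L) v ->
    ~ Omega_v° v -> trace K L g (x, v) = 0.

Definition approximation (k : nat) (f : X * X -> R) : Prop :=
  dg_space k f /\ vanishes_at_boundary f.

Definition field (E : X -> X) : Prop :=
  forall i, square_integrable leb Omega_x (fun x => E x ord0 i).

Inductive flux_type := Central | Upwind.

(* Coefficient of the jump terms in a step of length tau: the upwind flux is  *)
(* replaced by the downwind flux when tau < 0.                                *)
Definition jump_weight (fl : flux_type) (tau : R) : R :=
  match fl with Central => 0 | Upwind => Num.sg tau end.

Definition average (U1 U2 : X) : X := 2^-1 *: (U1 + U2).

Definition jump (n : X) (g1 g2 : R) : X := g1 *: n + g2 *: (- n).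

(* The flux of f *: a through an interface with unit normal n pointing from   *)
(* the side with trace f1 to the side with trace f2.                          *)
Definition numerical_flux (w : R) (a n : X) (f1 f2 : R) : R :=
  dot (average (f1 *: a) (f2 *: a) + (w * (`|dot a n| / 2)) *: jump n f1 f2) n.

(* The boundary of K is cut into the edges that K shares with the (translated *)
(* copies of) elements K' having the opposite normal. Only finitely many      *)
(* periods l contribute.                                                      *)
Definition x_boundary (w : R) (f g : X * X -> R) (K : Ix M) (L : Iv M) : R :=
  \sum_(i < facets (Tx K)) \sum_(K' : Ix M)
    \sum_(j < facets (Tx K') | normal (Tx K') j == - normal (Tx K) i)
      \sum_(l \in periods)
        \int[leb]_(v in cell (Tv L))
          \int[hyperplane_measure (normal (Tx K) i) (offset (Tx K) i)]_(x in
              facet (Tx K) i `&` [set x | facet (Tx K') j (x - l)])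
            (numerical_flux w v (normal (Tx K) i)
               (trace K L f (x, v)) (trace K' L f (x - l, v))
             * trace K L g (x, v)).

(* The last summand is the part of the boundary of L on the boundary of       *)
(* Omega_v, where the exterior value of f is 0.                               *)
Definition v_boundary (w : R) (f : X * X -> R) (E : X -> X) (g : X * X -> R)
    (K : Ix M) (L : Iv M) : R :=
  \sum_(i < facets (Tv L)) (
    \sum_(L' : Iv M)
      \sum_(j < facets (Tv L') | normal (Tv L') j == - normal (Tv L) i)
        \int[leb]_(x in cell (Tx K))
          \int[hyperplane_measure (normal (Tv L) i) (offset (Tv L) i)]_(v in
              facet (Tv L) i `&` facet (Tv L') j)
            (numerical_flux w (E x) (normal (Tv L) i)
               (trace K L f (x, v)) (trace K L' f (x, v))
             * trace K L g (x, v))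
    + \int[leb]_(x in cell (Tx K))
        \int[hyperplane_measure (normal (Tv L) i) (offset (Tv L) i)]_(v in
            facet (Tv L) i `\` Omega_v°)
          (numerical_flux w (E x) (normal (Tv L) i) (trace K L f (x, v)) 0
           * trace K L g (x, v))).

Definition grad_x (g : X * X -> R) (z : X * X) : X :=
  \row_i 'D_(delta_mx ord0 i) (fun x => g (x, z.2)) z.1.

Definition grad_v (g : X * X -> R) (z : X * X) : X :=
  \row_i 'D_(delta_mx ord0 i) (fun v => g (z.1, v)) z.2.

Definition BK (w : R) (f : X * X -> R) (E : X -> X) (g : X * X -> R)
    (K : Ix M) (L : Iv M) : R :=
  - (\int[leb2]_(z in element K L) (f z * dot z.2 (grad_x g z)))
  - (\int[leb2]_(z in element K L) (f z * dot (E z.1) (grad_v g z)))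
  + x_boundary w f g K L + v_boundary w f E g K L.

Definition current (f : X * X -> R) (x : X) : X :=
  \row_i \int[leb]_(v in Omega_v) (f (x, v) * v ord0 i).

Definition transport_step (k : nat) (fl : flux_type) (tau : R)
    (f0 f1 f : X * X -> R) (E : X -> X) : Prop :=
  forall K L g, dg_space k g ->
    \int[leb2]_(z in element K L) ((f1 z - f0 z) / tau * g z)
    + BK (jump_weight fl tau) f E g K L = 0.

Definition field_step (tau : R) (E0 E1 J : X -> X) : Prop :=
  {ae leb, forall x, Omega_x x -> tau^-1 *: (E1 x - E0 x) = - J x}.

Definition f_avg (f0 f1 : X * X -> R) : X * X -> R :=
  fun z => (f0 z + f1 z) / 2.

Definition field_avg (E0 E1 : X -> X) : X -> X := fun x => average (E0 x) (E1 x).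

Definition scheme1 (k : nat) (fl : flux_type) (tau : R)
    (f0 : X * X -> R) (E0 : X -> X) (f1 : X * X -> R) (E1 : X -> X) : Prop :=
  exists fh : X * X -> R,
  [/\ [/\ approximation k f0, approximation k fh & approximation k f1],
      field E0 /\ field E1,
      transport_step k fl (tau / 2) f0 fh f0 E0,
      field_step tau E0 E1 (current fh) &
      transport_step k fl tau f0 f1 fh (field_avg E0 E1)].

Definition scheme2 (k : nat) (fl : flux_type) (tau : R)
    (f0 : X * X -> R) (E0 : X -> X) (f1 : X * X -> R) (E1 : X -> X) : Prop :=
  [/\ approximation k f0 /\ approximation k f1,
      field E0 /\ field E1,
      transport_step k fl tau f0 f1 (f_avg f0 f1) (field_avg E0 E1) &
      field_step tau E0 E1 (field_avg (current f0) (current f1))].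

(* Eh is the intermediate field E^(n+1/2). *)
Definition scheme3 (k : nat) (fl : flux_type) (tau : R)
    (f0 : X * X -> R) (E0 Eh : X -> X) (f1 : X * X -> R) (E1 : X -> X) : Prop :=
  [/\ approximation k f0 /\ approximation k f1,
      [/\ field E0, field Eh & field E1],
      field_step (tau / 2) E0 Eh (current f0),
      transport_step k fl tau f0 f1 (f_avg f0 f1) Eh &
      field_step (tau / 2) Eh E1 (current f1)].

Definition beta1 : R := (2 + 2 `^ 3^-1 + 2 `^ (- 3^-1)) / 3.
Definition beta2 : R := 1 - 2 * beta1.
Definition beta3 : R := beta1.

Definition scheme2F (k : nat) (fl : flux_type) (tau : R)
    (f0 : X * X -> R) (E0 : X -> X) (f1 : X * X -> R) (E1 : X -> X) : Prop :=
  exists fa Ea fb Eb,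
  [/\ scheme2 k fl (beta3 * tau) f0 E0 fa Ea,
      scheme2 k fl (beta2 * tau) fa Ea fb Eb &
      scheme2 k fl (beta1 * tau) fb Eb f1 E1].

(* E^(n-1/2), given the sequences f^n, E^n and E^(n+1/2). *)
Definition E_before (tau : R) (f : nat -> X * X -> R) (E Eh : nat -> X -> X)
    (n : nat) : X -> X :=
  match n with
  | 0 => fun x => E 0%N x + (tau / 2) *: current (f 0%N) x
  | m.+1 => Eh m
  end.

Definition kinetic (f : X * X -> R) : R :=
  \int[leb]_(x in Omega_x) \int[leb]_(v in Omega_v) (f (x, v) * dot v v).

Definition field_product (E1 E2 : X -> X) : R :=
  \int[leb]_(x in Omega_x) dot (E1 x) (E2 x).

Definition TE (f : X * X -> R) (E : X -> X) : R :=
  (kinetic f + field_product E E) / 2.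

Definition TE3 (f : X * X -> R) (Eafter Ebefore : X -> X) : R :=
  (kinetic f + field_product Eafter Ebefore) / 2.

End dg.

(* Main.v *)
Require Import Defs.
From mathcomp Require Import all_boot all_order all_algebra.
From mathcomp Require Import all_classical all_reals all_analysis.
From mathcomp Require Import measurable_realfun ring lra.

Set Implicit Arguments.
Unset Strict Implicit.
Unset Printing Implicit Defensive.

Import Order.TTheory GRing.Theory Num.Theory.
Import numFieldNormedType.Exports.

Local Open Scope classical_set_scope.
Local Open Scope ring_scope.

(* Test the scheme with g = |v|^2, which lies in the DG space because k >= 2,  *)
(* and sum over all elements. Its trace is single valued and independent of x, *)
(* so the contributions of an interface seen from its two sides cancel (the    *)
(* numerical flux is antisymmetric), whatever the weight of the jump terms;    *)
(* grad_x g vanishes and grad_v g = 2 v leaves twice the work of E on the      *)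
(* current. Hence a step of length tau changes the kinetic term by             *)
(* 2 tau int E . J, and the updates of E, which hold almost everywhere, change *)
(* the field term by the opposite amount because int A . B is a symmetric      *)
(* bilinear form on square integrable fields.                                  *)

(** Particles and field exchange energy only through the work of [E] on the current, and each scheme
    evaluates this work identically on both sides. [transport_energy] is the particle side: a step
    of length [tau] raises the kinetic term by 2 tau int E . J, with the stage values of [f] and [E]
    that enter [BK]. [field_energy] is the field side: |E1|^2 - |E0|^2 = (E0 + E1) . (E1 - E0), so
    the update lowers the field term by 2 tau int (E0 + E1)/2 . J. [energy_balance] adds the two
    when the transport step uses the averaged field and the Ampere step the current of the same
    stage value of [f]. This covers Scheme-1, Scheme-2, and, as [tau] may have either sign, the
    composition Scheme-2F.

    In Scheme-3 the field is staggered: E^(n+3/2) - E^(n-1/2) = - tau (J^n + J^(n+1)), so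
    multiplying by E^(n+1/2) gives the same cancellation for the product of consecutive half-step
    fields.

    The particle side rests on [x_flux_antisym] and [v_flux_antisym], which compare an interface
    with itself seen from the other element, and on [sum_element], which reassembles integrals over
    elements up to a null set. Currents arise through [Rintegral_Fubini], so identities between
    fields hold almost everywhere only. *)

Lemma lebesgue_measure_translation (R : realType) (a : R)
    (A : set (measurableTypeR R)) :
  measurable A ->
  lebesgue_measure ((fun x : measurableTypeR R => x + a : measurableTypeR R) @^-1` A) =
  lebesgue_measure A.
Proof.
move=> mA.
pose t (x : measurableTypeR R) : measurableTypeR R := x + a.
have mt : measurable_fun setT t by exact: measurable_funD.
apply/esym/(@lebesgue_measure_unique R (pushforward lebesgue_measure t)) => //=.
move=> _ [[b c]] _ <-; rewrite /pushforward /=.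
rewrite (_ : _ @^-1` _ = `]b - a, c - a]%classic); last first.
  by apply/seteqP; split=> x /=; rewrite !in_itv/= ltrBlDr lerBrDr.
rewrite !lebesgue_measure_itv/= !lte_fin ltrD2r; case: ifP => // _.
by rewrite -!EFinB; congr (_%:E); ring.
Qed.

(** By induction on the dimension: the pushforward of the product measure under the translation
    agrees with it on rectangles, and these determine it. *)
Lemma lebesgue_rV_translation (R : realType) (n : nat) (l : 'rV[R]_n)
    (A : set 'rV[R]_n) :
  measurable A ->
  lebesgue_rV n ((fun y => y + l) @^-1` A) = lebesgue_rV n A.
Proof.
elim: n l A => [|n IH] l A mA.
  congr (_ _); apply/seteqP; split=> x /=; by rewrite (thinmx0 l) addr0.
rewrite /= /lebesgue_cons /pushforward.
pose l0 := l ord0 ord0; pose l' : 'rV[R]_n := \row_j l ord0 (lift ord0 j).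
pose s (p : measurableTypeR R * 'rV[R]_n) : measurableTypeR R * 'rV[R]_n :=
  ((p.1 + l0 : measurableTypeR R), p.2 + l').
have ms : measurable_fun setT s.
  apply: measurable_fun_pair; first exact: measurable_funD.
  apply: measurable_fun_rV => i; under eq_fun do rewrite mxE.
  by apply: measurable_funD => //; exact: measurableT_comp (measurable_rV_coord i) measurable_snd.
have -> : @rV_cons R n @^-1` ((fun y => y + l) @^-1` A) = s @^-1` (@rV_cons R n @^-1` A).
  apply/seteqP; split=> p /=; (rewrite (_ : rV_cons p + l = @rV_cons R n (s p)) //;
  apply/rowP => i; rewrite mxE; case: (unliftP ord0 i) => [j|] ->;
    rewrite ?rV_cons0 ?rV_consS ?mxE//).
have mB : measurable (@rV_cons R n @^-1` A).
  by rewrite -[X in measurable X]setTI; exact: measurable_rV_cons.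
apply/esym/(@product_measure_unique _ _ _ _ _ _ _
  (pushforward (lebesgue_measure \x lebesgue_rV n)%E s)) => // {mB}.
move=> B C mB mC; rewrite /= /pushforward.
rewrite (_ : s @^-1` _ = ((fun x : measurableTypeR R => x + l0 : measurableTypeR R) @^-1` B)
   `*` ((fun y => y + l') @^-1` C)); last by apply/seteqP; split.
rewrite product_measure1E.
- by congr (_ * _)%E; [exact: lebesgue_measure_translation|exact: IH].
- rewrite -[X in measurable X]setTI; apply: measurable_funD => //.
- rewrite -[X in measurable X]setTI; apply: measurable_fun_rV => // i.
  by under eq_fun do rewrite mxE; apply: measurable_funD => //; exact: measurable_rV_coord.
Qed.

Lemma measurable_hyperplane (R : realType) (n : nat) (u : 'rV[R]_n) (c : R) :
  measurable [set x | dot u x = c].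
Proof.
rewrite (_ : [set _ | _] = dot u @^-1` [set c]); last by [].
by rewrite -[X in measurable X]setTI; apply: (measurable_dot u).
Qed.

Lemma dot_rV_cons (R : realType) (n : nat) (u : 'rV[R]_n.+1) p :
  dot u (rV_cons p) =
  u ord0 ord0 * p.1 + dot (\row_j u ord0 (lift ord0 j)) p.2.
Proof.
rewrite /dot big_ord_recl rV_cons0; congr (_ + _).
by apply: eq_bigr => j _; rewrite rV_consS mxE.
Qed.

(** Slice by the first coordinate if the remaining part of [u] is nonzero: the slices are
    hyperplanes one dimension lower. Otherwise slice by the remaining coordinates: the slices are
    single points of the line. *)
Lemma lebesgue_rV_hyperplane (R : realType) (n : nat) (u : 'rV[R]_n) (c : R) :
  u != 0 -> lebesgue_rV n [set x | dot u x = c] = 0%E.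
Proof.
elim: n u c => [|n IH] u c u0; first by rewrite (thinmx0 u) eqxx in u0.
pose u' : 'rV[R]_n := \row_j u ord0 (lift ord0 j).
rewrite /= /lebesgue_cons /pushforward.
have mB : measurable (@rV_cons R n @^-1` [set x | dot u x = c]).
  rewrite -[X in measurable X]setTI; apply: measurable_rV_cons => //.
  exact: measurable_hyperplane.
have [u'0|u'0] := eqVneq u' 0; last first.
  apply: integral0_eq => a _ /=.
  rewrite (_ : xsection _ a = [set y | dot u' y = c - u ord0 ord0 * a]); first exact: IH.
  apply/seteqP; split=> y; rewrite /xsection/= inE/= dot_rV_cons/= -/u'.
    by move=> <-; rewrite addrC addKr.
  by move=> ->; rewrite addrC subrK.
have u00 : u ord0 ord0 != 0.
  apply: contra_neq u0 => u00; apply/rowP => i; rewrite mxE.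
  case: (unliftP ord0 i) => [j|] -> //.
  by move/rowP : u'0 => /(_ j); rewrite !mxE.
(* The order of integration is exchanged, so that sections at a fixed tail are measured. *)
rewrite (product_measure_unique (m' := (lebesgue_measure \x^ lebesgue_rV n)%E))//; last first.
  by move=> A B mA mC; rewrite /= product_measure2E.
apply: integral0_eq => y _ /=.
rewrite (_ : ysection _ y = [set c / u ord0 ord0]); first exact: lebesgue_measure_set1.
apply/seteqP; split=> a; rewrite /ysection/= inE/= dot_rV_cons/= -/u' u'0.
  rewrite /dot big1 ?addr0; last by move=> i _; rewrite mxE mul0r.
  by move=> <-; rewrite mulrAC divff ?mul1r.
move=> ->; rewrite /dot big1 ?addr0; last by move=> i _; rewrite mxE mul0r.
by rewrite mulrC divfK.
Qed.

Lemma measurable_cube (R : realType) (n : nat) (C : R) :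
  measurable [set x : 'rV[R]_n | forall i, `|x ord0 i| <= C].
Proof.
rewrite (_ : [set _ | _] = \bigcap_(i in [set: 'I_n]) rV_coord i @^-1` `[- C, C]); last first.
  apply/seteqP; split => x /=.
    by move=> h i _; rewrite /= in_itv/= -ler_norml; exact: h.
  by move=> h i; have := h i I; rewrite /= in_itv/= -ler_norml.
apply: fin_bigcap_measurable => // i _.
by rewrite -[X in measurable X]setTI; exact: measurable_rV_coord.
Qed.

Lemma lebesgue_rV_cube (R : realType) (n : nat) (C : R) :
  (lebesgue_rV n [set x : 'rV[R]_n | forall i, `|x ord0 i| <= C]%R < +oo)%E.
Proof.
elim: n => [|n IH]; first by rewrite /= diracE ltry.
rewrite /= /lebesgue_cons /pushforward.
rewrite (_ : _ @^-1` _ = `[- C, C]%classic `*` [set x : 'rV[R]_n | forall i, `|x ord0 i| <= C]).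
  rewrite product_measure1E//; last exact: measurable_cube.
  rewrite lte_mul_pinfty//.
    by rewrite ge0_fin_numE//= lebesgue_measure_itv/=; case: ifP => _; rewrite ?ltry// -EFinB ltry.
apply/seteqP; split => p /=.
  move=> h; split; first by have := h ord0; rewrite rV_cons0 ler_norml in_itv.
  by move=> i /=; have := h (lift ord0 i); rewrite rV_consS.
move=> [+ h] i; rewrite in_itv/= -ler_norml.
by case: (unliftP ord0 i) => [j|] ->; rewrite ?rV_consS ?rV_cons0.
Qed.

Lemma lebesgue_rV_bounded (R : realType) (n : nat) (A : set 'rV[R]_n) (C : R) :
  measurable A -> (forall x, A x -> forall i, `|x ord0 i| <= C) ->
  (lebesgue_rV n A < +oo)%E.
Proof.
move=> mA AC; apply: le_lt_trans (lebesgue_rV_cube n C).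
by apply: le_measure; rewrite ?inE//; exact: measurable_cube.
Qed.

(** * Dot product, surface measures on hyperplanes, change of variables *)

Lemma dotNl (R : realType) (n : nat) (u v : 'rV[R]_n) : dot (- u) v = - dot u v.
Proof. by rewrite /dot -sumrN; apply: eq_bigr => i _; rewrite mxE mulNr. Qed.

Lemma dotDr (R : realType) (n : nat) (u v w : 'rV[R]_n) :
  dot u (v + w) = dot u v + dot u w.
Proof. by rewrite /dot -big_split; apply: eq_bigr => i _; rewrite mxE mulrDr. Qed.

Lemma dotZr (R : realType) (n : nat) (a : R) (u v : 'rV[R]_n) :
  dot u (a *: v) = a * dot u v.
Proof. by rewrite /dot mulr_sumr; apply: eq_bigr => i _; rewrite mxE mulrCA. Qed.

Lemma dotC (R : realType) (n : nat) (u v : 'rV[R]_n) : dot u v = dot v u.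
Proof. by apply: eq_bigr => i _; rewrite mulrC. Qed.

Lemma dotNr (R : realType) (n : nat) (u v : 'rV[R]_n) : dot u (- v) = - dot u v.
Proof. by rewrite dotC dotNl dotC. Qed.

Lemma dotDl (R : realType) (n : nat) (u v w : 'rV[R]_n) :
  dot (v + w) u = dot v u + dot w u.
Proof. by rewrite dotC dotDr !(dotC u). Qed.

Lemma dotZl (R : realType) (n : nat) (a : R) (u v : 'rV[R]_n) :
  dot (a *: v) u = a * dot v u.
Proof. by rewrite dotC dotZr dotC. Qed.

(** The two elements at an interface describe its hyperplane by opposite data; the signed distance
    changes sign, which alters neither the cylinder nor the projection. *)
Lemma hyperplane_measureN (R : realType) (d : nat) (u : 'rV[R]_d) (c : R) A :
  hyperplane_measure (- u) (- c) A = hyperplane_measure u c A.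
Proof.
congr (lebesgue_rV _ _); apply/seteqP.
have e y : dot (- u) y - - c = - (dot u y - c) by rewrite dotNl; ring.
by split => y; rewrite /hyperplane_cylinder /hyperplane_proj /= e normrN scalerN scaleNr opprK.
Qed.

(** Needed for facets that are glued periodically: the cylinder over a translated base is the
    translated cylinder. *)
Lemma hyperplane_measure_translation (R : realType) (d : nat) (u l : 'rV[R]_d)
    (c : R) A :
  measurable A ->
  hyperplane_measure u (c - dot u l) ((fun x => x + l) @^-1` A) = hyperplane_measure u c A.
Proof.
move=> mA; rewrite /hyperplane_measure.
rewrite -(lebesgue_rV_translation l (measurable_hyperplane_cylinder _ _ mA)).
have e y : dot u (y + l) - c = dot u y - (c - dot u l) by rewrite dotDr; ring.
congr (lebesgue_rV _ _); apply/seteqP.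
by split => y; rewrite /hyperplane_cylinder /hyperplane_proj /= e addrAC.
Qed.

(* No integrability is needed: as [+oo - +oo = -oo] and [fine] maps infinities to
   [0], a divergent integral and its opposite are both [0]. *)
Lemma RintegralN (R : realType) d (T : measurableType d)
    (mu : {measure set T -> \bar R}) (D : set T) (f : T -> R) :
  \int[mu]_(x in D) (- f x) = - \int[mu]_(x in D) f x.
Proof.
rewrite /Rintegral integralE [X in _ = - fine X]integralE.
rewrite (_ : (fun x => (- f x)%:E) = (\- (EFin \o f))%E); last by apply/funext.
rewrite funeposN funenegN -[fun x => (f x)%:E]/(EFin \o f).
have : (0 <= \int[mu]_(x in D) (EFin \o f)^\+ x)%E by exact: integral_ge0.
have : (0 <= \int[mu]_(x in D) (EFin \o f)^\- x)%E by exact: integral_ge0.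
move: (integral _ _ _) (integral _ _ _) => [a| |] [b| |] //= _ _; rewrite ?oppr0 //.
by rewrite opprB.
Qed.

(** The formula for non-negative functions is applied to the positive and negative parts separately,
    so divergent integrals are covered as well. *)
Lemma Rintegral_measure_preserving (R : realType) d (T : measurableType d)
    (m m' : {measure set T -> \bar R}) (phi : T -> T) (D : set T) (f : T -> R) :
  measurable_fun setT phi ->
  (forall A, measurable A -> m (phi @^-1` A) = m' A) ->
  measurable D -> measurable_fun D f ->
  \int[m']_(x in D) f x = \int[m]_(x in phi @^-1` D) f (phi x).
Proof.
move=> mphi mm' mD /measurable_EFinP mf; rewrite /Rintegral; congr fine.
have main (g : T -> \bar R) : measurable_fun D g -> (forall x, 0 <= g x)%E ->
    (\int[m']_(x in D) g x = \int[m]_(x in phi @^-1` D) g (phi x))%E.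
  move=> mg g0; rewrite -(ge0_integral_pushforward mphi)//.
  apply/esym; apply: (@eq_measure_integral _ _ _ _ m' (pushforward m phi)) => A mA _; exact: mm'.
rewrite integralE [RHS]integralE; congr (_ - _)%E.
  by rewrite main//; [apply: eq_integral => x _; rewrite !funeposE|exact/measurable_funepos].
by rewrite main//; [apply: eq_integral => x _; rewrite !funenegE|exact/measurable_funeneg].
Qed.

(** * Geometry of boxes and simplices *)

Lemma measurable_cell (R : realType) (d : nat) (K : polytope R d) :
  measurable (cell K).
Proof.
rewrite (_ : cell K =
    \bigcap_(i in [set: 'I_(facets K)]) dot (normal K i) @^-1` `]-oo, offset K i[).
  apply: fin_bigcap_measurable => // i _.
  by rewrite -[X in measurable X]setTI; exact: measurable_dot.
apply/seteqP; split => x h i => [_|]; first by rewrite /= in_itv/=.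
by have := h i I; rewrite /= in_itv/=.
Qed.

Lemma measurable_closed_cell (R : realType) (d : nat) (K : polytope R d) :
  measurable (closed_cell K).
Proof.
rewrite (_ : closed_cell K =
    \bigcap_(i in [set: 'I_(facets K)]) dot (normal K i) @^-1` `]-oo, offset K i]).
  apply: fin_bigcap_measurable => // i _.
  by rewrite -[X in measurable X]setTI; exact: measurable_dot.
apply/seteqP; split => x h i => [_|]; first by rewrite /= in_itv/=.
by have := h i I; rewrite /= in_itv/=.
Qed.

Lemma measurable_facet (R : realType) (d : nat) (K : polytope R d) i :
  measurable (facet K i).
Proof.
by apply: measurableI; [exact: measurable_closed_cell|exact: measurable_hyperplane].
Qed.

Definition is_mesh_cell (R : realType) (d : nat) (K : polytope R d) :=
  is_cartesian K \/ is_simplex K.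

Lemma is_mesh_cell_unit_normals (R : realType) (d : nat) (K : polytope R d) :
  is_mesh_cell K -> unit_normals K.
Proof. by case=> -[]. Qed.

(** Positive slack [w] in finitely many inequalities absorbs a small multiple of any displacement
    [v]. *)
Lemma uniform_scaling (R : realType) (I : finType) (v w : I -> R) :
  (forall i, 0 <= v i) -> (forall i, 0 < w i) ->
  exists2 e : R, 0 < e & forall i, e * v i <= w i.
Proof.
move=> v0 w0.
have s0 : 0 <= \sum_i v i / w i by apply: sumr_ge0 => i _; rewrite divr_ge0// ltW.
exists (1 + \sum_i v i / w i)^-1; first by rewrite invr_gt0 ltr_wpDr.
move=> i; rewrite mulrC ler_pdivrMr ?ltr_wpDr// mulrC -ler_pdivrMr//.
rewrite (bigD1 i)//= addrCA lerDl addr_ge0// sumr_ge0// => j _.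
by rewrite divr_ge0// ltW.
Qed.

(** A small move along the unit normal of a facet increases the left side of that facet's inequality
    by [e > 0] and still satisfies it, so the inequality is strict at [m]. This turns the
    descriptions by intervals or vertices into information on the half-spaces. *)
Lemma cell_of_interior (R : realType) (d : nat) (K : polytope R d)
    (m : 'rV[R]_d) :
  unit_normals K ->
  (forall u : 'rV[R]_d, exists2 e : R, 0 < e & closed_cell K (m + e *: u)) -> cell K m.
Proof.
move=> uK h i; have [e e0 /(_ i)] := h (normal K i).
by rewrite dotDr dotZr uK; apply: lt_le_trans; rewrite ltrDl mulr1.
Qed.

(** The centre of the box, respectively the barycentre of the simplex, can be moved a little in
    every direction. *)
Lemma cell_nonempty (R : realType) (d : nat) (K : polytope R d) :
  is_mesh_cell K -> cell K !=set0.
Proof.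
case=> -[_ uK].
  move=> [a [b [ab Kab]]]; exists (\row_i ((a ord0 i + b ord0 i) / 2)).
  apply: cell_of_interior => // u.
  have [e e0 he] := @uniform_scaling R _ (fun i => `|u ord0 i|)
    (fun i => (b ord0 i - a ord0 i) / 2) (fun i => normr_ge0 _)
    (fun i => ltac:(by rewrite divr_gt0 ?subr_gt0)).
  exists e => //; rewrite Kab => i; rewrite !mxE.
  have := he i; rewrite /= -[e in e * _]gtr0_norm// -normrM ler_norml.
  by move: (e * _) => eu /andP[? ?]; apply/andP; split; lra.
move=> [p [Afree Kp]]; set A := (\matrix_i _) in Afree.
exists (\sum_i (d.+1%:R)^-1 *: p i); apply: cell_of_interior => // u.
have uA : A \in unitmx by rewrite -row_free_unit.
(* [q] holds the coordinates of [u] in the edges issuing from [p ord0]; [g] completes them to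
   barycentric increments, which sum to zero and reproduce [u]. *)
pose q := u *m invmx A.
pose g (i : 'I_d.+1) := if unlift ord0 i is Some j then q ord0 j else - \sum_j q ord0 j.
have g0 : g ord0 = - \sum_j q ord0 j by rewrite /g unlift_none.
have gS j : g (lift ord0 j) = q ord0 j by rewrite /g liftK.
have gp : \sum_i g i *: p i = u.
  rewrite big_ord_recl g0 scaleNr scaler_suml -sumrN -big_split/=.
  rewrite -[RHS](mulmxKV uA) -/q; apply/rowP => k; rewrite summxE mxE.
  by apply: eq_bigr => j _; rewrite gS !mxE; ring.
have [e e0 he] := @uniform_scaling R _ (fun i => `|g i|)
    (fun i : 'I_d.+1 => (d.+1%:R)^-1) (fun i => normr_ge0 _)
    (fun i => ltac:(by rewrite invr_gt0 ltr0Sn)).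
exists e => //; rewrite Kp; exists (fun i => (d.+1%:R)^-1 + e * g i); split.
- move=> i; have := he i; rewrite /= -[e in e * _]gtr0_norm// -normrM ler_norml.
  by move=> /andP[? _]; rewrite -lerBlDl sub0r.
- rewrite big_split/= sumr_const card_ord -[_ *+ d.+1]mulr_natl divff ?pnatr_eq0//.
  rewrite -mulr_sumr big_ord_recl g0.
  rewrite [X in - _ + X](eq_bigr (fun j => q ord0 j)); last by move=> j _; exact: gS.
  by rewrite addNr mulr0 addr0.
- rewrite -gp scaler_sumr -big_split/=.
  by apply: eq_bigr => i _; rewrite scalerDl scalerA.
Qed.

Lemma closed_cell_bounded (R : realType) (d : nat) (K : polytope R d) :
  is_mesh_cell K ->
  exists C, forall x, closed_cell K x -> forall i, `|x ord0 i| <= C.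
Proof.
case=> -[_ _].
  move=> [a [b [ab ->]]]; exists (\sum_i (`|a ord0 i| + `|b ord0 i|)) => x h i.
  rewrite (bigD1 i)//= -[leLHS]addr0 lerD//; last first.
    by apply: sumr_ge0 => j _; rewrite addr_ge0.
  have /andP[ax xb] := h i; rewrite ler_norml; apply/andP; split.
    have := ler_norm (- a ord0 i); rewrite normrN.
    have := normr_ge0 (b ord0 i); lra.
  by have := ler_norm (b ord0 i); have := normr_ge0 (a ord0 i); lra.
move=> [p [_ ->]]; exists (\sum_i \sum_j `|p i ord0 j|) => x [w [w0 w1 ->]] j.
rewrite summxE; apply: le_trans (ler_norm_sum _ _ _) _; apply: ler_sum => i _.
rewrite mxE normrM (bigD1 j)//= -[leLHS]addr0 lerD ?sumr_ge0//.
rewrite ler_piMl// ger0_norm// -w1 (bigD1 i)//= lerDl.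
by apply: sumr_ge0 => *.
Qed.

(** Each constraint is a convex combination of a weak inequality and, with weight [t > 0], a strict
    one. *)
Lemma cell_segment (R : realType) (d : nat) (K : polytope R d) (x y : 'rV[R]_d)
    (t : R) :
  closed_cell K x -> cell K y -> 0 < t <= 1 -> cell K (x + t *: (y - x)).
Proof.
move=> Kx Ky /andP[t0 t1] i; have := Kx i; have := Ky i.
rewrite dotDr dotZr dotDr dotNr.
set a := dot _ y; set b := dot _ x; set c := offset _ _ => ac bc.
rewrite (_ : _ + _ = (1 - t) * b + t * a); last by ring.
rewrite (_ : c = (1 - t) * c + t * c); last by ring.
by rewrite ler_ltD// ?ltr_pM2l// ler_wpM2l// subr_ge0.
Qed.

(** Follow the segment from an interior point towards [z]. This makes the filter in [trace] proper,
    so that a limit along it is unique. *)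
Lemma closure_element (R : realType) (d : nat) (K L : polytope R d)
    (z : 'rV[R]_d * 'rV[R]_d) :
  is_mesh_cell K -> is_mesh_cell L ->
  closed_cell K z.1 -> closed_cell L z.2 -> closure (cell K `*` cell L) z.
Proof.
move=> /cell_nonempty[y1 Ky1] /cell_nonempty[y2 Ly2] Kz Lz B Bz.
pose y := (y1, y2).
have : z + t *: (y - z) @[t --> (0 : R)^'+] --> z + 0 *: (y - z).
  apply: cvgD; first exact: cvg_cst.
  by apply: cvgZr_tmp; apply: cvg_at_right_filter; exact: cvg_id.
rewrite scale0r addr0 => h.
have hB : \forall t \near (0 : R)^'+, B (z + t *: (y - z)) by exact: h.
have [t [Bt t01]] : exists t, B (z + t *: (y - z)) /\ 0 < t <= 1.
  apply: (@filter_ex _ (0 : R)^'+); near=> t; split; first by near: t.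
  by apply/andP; split; near: t; [exact: nbhs_right_gt|exact: nbhs_right_le].
exists (z + t *: (y - z)); split => //.
by split; [exact: (cell_segment Kz Ky1)|exact: (cell_segment Lz Ly2)].
Unshelve. all: by end_near. Qed.

(** * Traces of piecewise polynomials *)

Lemma trace_eq (R : realType) (d : nat) (M : phase_mesh R d) K L
    (g p : 'rV[R]_d * 'rV[R]_d -> R) (z : 'rV[R]_d * 'rV[R]_d) :
  is_mesh_cell (Tx K) -> is_mesh_cell (Tv L) ->
  closed_cell (Tx K) z.1 -> closed_cell (Tv L) z.2 -> continuous p ->
  (forall y, element K L y -> g y = p y) ->
  trace (M := M) K L g z = p z.
Proof.
move=> hK hL Kz Lz cp gp; apply: cvg_lim => //.
  exact: within_nbhs_proper (closure_element hK hL Kz Lz).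
have : p @ within (element K L) (nbhs z) --> p z.
  apply: cvg_trans (cp z); apply: cvg_app; exact: cvg_within.
apply: cvg_trans; apply: near_eq_cvg.
by apply: filterS (withinT _ (nbhs_filter z)) => y /gp ->.
Qed.

(** One global polynomial represents the function inside the element and its trace up to the
    boundary. Measurability in [x] at fixed [v] serves the change of variables on facets; it is
    derived from the coordinates, which generate the sigma-algebra. *)
Lemma polynomial_on_trace (R : realType) (d : nat) (M : phase_mesh R d) k K L
    (g : 'rV[R]_d * 'rV[R]_d -> R) :
  is_mesh_cell (Tx K) -> is_mesh_cell (Tv L) ->
  polynomial_on k (element (M := M) K L) g ->
  exists p : 'rV[R]_d * 'rV[R]_d -> R,
  [/\ continuous p, forall v, measurable_fun setT (fun x => p (x, v)),
      forall y, element K L y -> g y = p y &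
      forall x v, closed_cell (Tx K) x -> closed_cell (Tv L) v ->
        trace K L g (x, v) = p (x, v)].
Proof.
move=> hK hL [c gc].
pose p (z : 'rV[R]_d * 'rV[R]_d) :=
  \sum_(a : {ffun 'I_(d + d) -> 'I_k.+1} | (\sum_i a i <= k)%N)
    c a * \prod_i row_mx z.1 z.2 ord0 i ^+ a i.
have cp : continuous p.
  rewrite /p; apply: (@continuous_big _ _ (+%R : R -> R -> R) 0 _ _ _ _
    (fun a (z : 'rV[R]_d * 'rV[R]_d) => c a * \prod_i row_mx z.1 z.2 ord0 i ^+ a i)) =>
    [|a _ z]; first exact: add_continuous.
  apply: cvgM; first exact: cvg_cst.
  move: z; apply: (@continuous_big _ _ ( *%R : R -> R -> R) 1 _ _ _ _
    (fun i (z : 'rV[R]_d * 'rV[R]_d) => row_mx z.1 z.2 ord0 i ^+ a i)) => [|i _ z].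
    by move=> y; apply: cvgM; [exact: cvg_fst|exact: cvg_snd].
  apply: (@continuous_comp _ _ _
    (fun y : 'rV[R]_d * 'rV[R]_d => row_mx y.1 y.2 ord0 i)
    (fun x : R => x ^+ a i)); last exact: exprn_continuous.
  rewrite (_ : (fun y : 'rV[R]_d * 'rV[R]_d => row_mx y.1 y.2 ord0 i) =
     (fun y => match fintype.split i with inl j => y.1 ord0 j | inr j => y.2 ord0 j end)).
    case: fintype.split => j.
      apply: (@continuous_comp _ _ _ fst (fun x : 'rV[R]_d => x ord0 j)); last exact: coord_continuous.
    exact: cvg_fst.
    apply: (@continuous_comp _ _ _ snd (fun x : 'rV[R]_d => x ord0 j)); last exact: coord_continuous.
    exact: cvg_snd.
  by apply/funext => y; rewrite mxE; case: fintype.split.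
exists p; split => //; last by move=> x v Kx Lv; exact: trace_eq.
move=> v; rewrite (_ : (fun x => p (x, v)) = fun x => \sum_(a : {ffun 'I_(d + d) -> 'I_k.+1})
    if (\sum_i a i <= k)%N then c a * \prod_i row_mx x v ord0 i ^+ a i else 0); last first.
  by apply/funext => x; rewrite /p big_mkcond.
apply: measurable_sum => a; case: (_ <= k)%N => //; apply: measurable_funM => //.
apply: measurable_prod => i _; apply: measurable_funX.
rewrite (_ : (fun x => row_mx x v ord0 i) =
  (fun x => match fintype.split i with inl j => @rV_coord R d j x | inr j => v ord0 j end)).
  by case: fintype.split => j //; exact: measurable_rV_coord.
by apply/funext => y; rewrite mxE; case: fintype.split.
Qed.

(** * Cancellation of the numerical fluxes *)

Lemma numerical_fluxE (R : realType) (d : nat) (w : R) (a n : 'rV[R]_d)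
    (f1 f2 : R) :
  numerical_flux w a n f1 f2 =
  (f1 + f2) / 2 * dot a n + w * (`|dot a n| / 2) * ((f1 - f2) * dot n n).
Proof.
by rewrite /numerical_flux /average /jump !(dotDl, dotZl) dotNl; field.
Qed.

(** Average and jump are unchanged when the sides and the normal are exchanged together; only the
    final product with the normal changes sign. As [w] is arbitrary, central, upwind and downwind
    fluxes are treated at once. *)
Lemma numerical_flux_antisym (R : realType) (d : nat) (w : R) (a n : 'rV[R]_d)
    (f1 f2 : R) :
  numerical_flux w a (- n) f2 f1 = - numerical_flux w a n f1 f2.
Proof. by rewrite !numerical_fluxE !dotNr dotNl normrN; ring. Qed.

(** Exchanging the roles of [(K, i)] and [(K', j)] shows that the sum equals its own opposite. *)
Lemma antisymmetric_facet_sum (R : realType) (I : finType) (n : I -> nat)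
    (P : forall K K' : I, 'I_(n K) -> 'I_(n K') -> bool)
    (S : forall K K' : I, 'I_(n K) -> 'I_(n K') -> R) :
  (forall K K' i j, P K K' i j = P K' K j i) ->
  (forall K K' i j, P K K' i j -> S K K' i j = - S K' K j i) ->
  \sum_K \sum_(i < n K) \sum_K' \sum_(j < n K' | P K K' i j) S K K' i j = 0.
Proof.
move=> Psym Santi; set s := LHS.
have {Santi} sN : s = - s.
  rewrite {1}/s; under eq_bigr do rewrite exchange_big.
  rewrite exchange_big -sumrN; apply: eq_bigr => K _ /=.
  rewrite exchange_big/= -sumrN; apply: eq_bigr => K' _.
  rewrite (exchange_big_dep xpredT)//= -sumrN; apply: eq_bigr => i _.
  rewrite -sumrN (eq_bigl (fun j => P K K' i j)); last by move=> j; rewrite Psym.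
  by apply: eq_bigr => j; rewrite Psym => /Santi.
lra.
Qed.

(* Over an infinite support both sums are [0]. *)
Lemma fsumrN (R : idomainType) (T : choiceType) (A : set T) (F : T -> R) :
  \sum_(i \in A) - F i = - \sum_(i \in A) F i.
Proof. by rewrite -mulN1r mulr_fsumr; apply: eq_fsbigr => i _; rewrite mulN1r. Qed.

Lemma periodsN (R : realType) (d : nat) (M : phase_mesh R d) l :
  periods M l -> periods M (- l).
Proof. by move=> [m _ <-]; exists (- m) => //; rewrite map_mxN mulNmx. Qed.

(** Facets are paired by opposite normals alone; a single common point then forces them onto the
    same hyperplane, up to the period. *)
Lemma facet_offset (R : realType) (d : nat) (K K' : polytope R d) i j
    (x l : 'rV[R]_d) :
  normal K' j = - normal K i -> facet K i x -> facet K' j (x - l) ->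
  offset K' j = - (offset K i - dot (normal K i) l).
Proof. by move=> nij [_ /= <-] [_ /= <-]; rewrite nij dotNl dotDr dotNr. Qed.

(** The innermost summand of [x_boundary], isolated so that its two sides can be exchanged. *)
Definition x_interface (R : realType) (d : nat) (M : phase_mesh R d) (w : R)
    (f g : 'rV[R]_d * 'rV[R]_d -> R) (L : Iv M) (K K' : Ix M)
    (i : 'I_(facets (Tx K))) (j : 'I_(facets (Tx K'))) (l : 'rV[R]_d) : R :=
  \int[lebesgue_rV d]_(v in cell (Tv L))
    \int[hyperplane_measure (normal (Tx K) i) (offset (Tx K) i)]_(x in
        facet (Tx K) i `&` [set x | facet (Tx K') j (x - l)])
      (numerical_flux w v (normal (Tx K) i)
         (trace K L f (x, v)) (trace K' L f (x - l, v))
       * trace K L g (x, v)).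

(* Substituting [x + l] for [x] turns the surface measure on the facet of [K]
   into the one on the facet of [K']. *)
Lemma x_flux_antisym (R : realType) (d : nat) (M : phase_mesh R d) (k : nat)
    (w : R)
    (f g : 'rV[R]_d * 'rV[R]_d -> R) (q : 'rV[R]_d -> R) L K K' i j l :
  is_mesh (@Tx _ _ M) -> is_mesh (@Tv _ _ M) ->
  (forall K L, polynomial_on k (element (M := M) K L) f) ->
  (forall K L x v, closed_cell (Tx K) x -> closed_cell (Tv L) v ->
     trace (M := M) K L g (x, v) = q v) ->
  normal (Tx K') j = - normal (Tx K) i ->
  x_interface (M := M) w f g L i j l = - x_interface (M := M) w f g L j i (- l).
Proof.
move=> [mx _] [mv _] pf gq nij; rewrite /x_interface -RintegralN.
apply: eq_Rintegral => v /set_mem Lv.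
have {}Lv : closed_cell (Tv L) v by move=> a; exact/ltW/Lv.
have [p [cp mp fp tp]] := polynomial_on_trace (mx K) (mv L) (pf K L).
have [p' [cp' mp' fp' tp']] := polynomial_on_trace (mx K') (mv L) (pf K' L).
set D := _ `&` _; set D' := _ `&` _.
have DD' : (fun y => y + l) @^-1` D = D'.
  apply/seteqP; split => y; rewrite /D /D' /= addrK opprK; by case.
have mtr : measurable_fun setT (fun y : 'rV[R]_d => y + l).
  apply: measurable_fun_rV => a; under eq_fun do rewrite mxE.
  by apply: measurable_funD => //; exact: measurable_rV_coord.
have mtr' : measurable_fun setT (fun y : 'rV[R]_d => y - l).
  apply: measurable_fun_rV => a; under eq_fun do rewrite mxE.
  by apply: measurable_funD => //; exact: measurable_rV_coord.
have mD : measurable D.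
  apply: measurableI; first exact: measurable_facet.
  rewrite -[X in measurable X]setTI; apply: mtr' => //; exact: measurable_facet.
(* If the facets do not meet, both integrals are over the empty set; otherwise a common point
   relates the offsets. *)
have [D0|/set0P[x0 [Kx0 Kx0']]] := eqVneq D set0.
  by rewrite -DD' D0 preimage_set0 !Rintegral_set0 oppr0.
have cij := facet_offset nij Kx0 Kx0'.
(* The change of variables needs a measurable integrand, so the traces of [f] are replaced by their
   polynomials. *)
rewrite (eq_Rintegral _ (g := fun x =>
  numerical_flux w v (normal (Tx K) i) (p (x, v)) (p' (x - l, v)) * q v)); last first.
  by move=> x /set_mem [[Kx _] [Kx' _]]; rewrite tp// tp'// gq.
rewrite (@Rintegral_measure_preserving _ _ _
  (hyperplane_measure (normal (Tx K') j) (offset (Tx K') j)) _ (fun y => y + l))//; first last.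
- under eq_fun do rewrite numerical_fluxE.
  have m1 : measurable_fun D (fun x => p (x, v)) by exact: measurable_funTS.
  have m2 : measurable_fun D (fun x => p' (x - l, v)).
    apply: measurable_funTS; exact: (measurableT_comp (mp' v) mtr').
  apply: measurable_funM => //; apply: measurable_funD.
    apply: measurable_funM => //; apply: measurable_funM => //; exact: measurable_funD.
  apply: measurable_funM => //; apply: measurable_funM => //; exact: measurable_funB.
- by move=> A mA; rewrite /= nij cij hyperplane_measureN hyperplane_measure_translation.
rewrite DD' -RintegralN; apply: eq_Rintegral => y /set_mem [[Ky _] [Ky' _]].
rewrite opprK in Ky' *; rewrite tp'// tp// gq// addrK nij numerical_flux_antisym.
by rewrite mulNr opprK.
Qed.

Lemma sum_x_boundary (R : realType) (d : nat) (M : phase_mesh R d) (k : nat)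
    (w : R)
    (f g : 'rV[R]_d * 'rV[R]_d -> R) (q : 'rV[R]_d -> R) L :
  is_mesh (@Tx _ _ M) -> is_mesh (@Tv _ _ M) ->
  (forall K L, polynomial_on k (element (M := M) K L) f) ->
  (forall K L x v, closed_cell (Tx K) x -> closed_cell (Tv L) v ->
     trace (M := M) K L g (x, v) = q v) ->
  \sum_K x_boundary (M := M) w f g K L = 0.
Proof.
move=> mx mv pf gq.
apply: (@antisymmetric_facet_sum _ _ (fun K => facets (Tx K))
  (fun K K' i j => normal (Tx K') j == - normal (Tx K) i)
  (fun K K' i j => \sum_(l \in periods M) x_interface (M := M) w f g L i j l)) =>
  [K K' i j|K K' i j /eqP nij].
  by apply/eqP/eqP => ->; rewrite opprK.
(* Seen from [K'], the neighbouring copy of [K] is shifted by the opposite period. *)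
rewrite -fsumrN (reindex_fsbig (fun l => - l) (periods M)).
  by apply: eq_fsbigr => l _; rewrite (x_flux_antisym w _ _ mx mv pf gq nij) opprK.
split.
- by move=> l /periodsN.
- by move=> l l' _ _ /oppr_inj.
- by move=> l /periodsN ml; exists (- l) => //; rewrite opprK.
Qed.

Definition v_interface (R : realType) (d : nat) (M : phase_mesh R d) (w : R)
    (f g : 'rV[R]_d * 'rV[R]_d -> R) (E : 'rV[R]_d -> 'rV[R]_d) (K : Ix M)
    (L L' : Iv M) (i : 'I_(facets (Tv L))) (j : 'I_(facets (Tv L'))) : R :=
  \int[lebesgue_rV d]_(x in cell (Tx K))
    \int[hyperplane_measure (normal (Tv L) i) (offset (Tv L) i)]_(v in
        facet (Tv L) i `&` facet (Tv L') j)
      (numerical_flux w (E x) (normal (Tv L) i)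
         (trace K L f (x, v)) (trace K L' f (x, v))
       * trace K L g (x, v)).

(** There is no period in [v]: facets that meet lie in one hyperplane, and their surface measures
    coincide. *)
Lemma v_flux_antisym (R : realType) (d : nat) (M : phase_mesh R d) (w : R)
    (f g : 'rV[R]_d * 'rV[R]_d -> R) (E : 'rV[R]_d -> 'rV[R]_d) (q : 'rV[R]_d -> R) K L L' i j :
  (forall K L x v, closed_cell (Tx K) x -> closed_cell (Tv L) v ->
     trace (M := M) K L g (x, v) = q v) ->
  normal (Tv L') j = - normal (Tv L) i ->
  v_interface (M := M) w f g E K i j = - v_interface (M := M) w f g E K j i.
Proof.
move=> gq nij; rewrite /v_interface -RintegralN.
apply: eq_Rintegral => x /set_mem Kx.
have {}Kx : closed_cell (Tx K) x by move=> a; exact/ltW/Kx.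
rewrite [X in Rintegral _ X _ = - _]setIC.
have [D0|/set0P[v0 [Lv0' Lv0]]] := eqVneq (facet (Tv L') j `&` facet (Tv L) i) set0.
  by rewrite D0 !Rintegral_set0 oppr0.
have := @facet_offset _ _ _ _ i j v0 0 nij Lv0.
rewrite subr0 => /(_ Lv0'); rewrite /dot big1 ?subr0 => [cij|a _]; last by rewrite mxE mulr0.
rewrite -RintegralN {1}/Rintegral.
rewrite (eq_measure_integral
  (hyperplane_measure (normal (Tv L') j) (offset (Tv L') j))); last first.
  by move=> A _ _; rewrite /= nij cij hyperplane_measureN.
apply: eq_Rintegral => v /set_mem [[Lv' _] [Lv _]].
by rewrite !gq// nij numerical_flux_antisym mulNr opprK.
Qed.

(** On the boundary of [Omega_v] both the trace of [f] and the exterior value are zero, hence so is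
    the flux; the interior interfaces cancel in pairs. *)
Lemma sum_v_boundary (R : realType) (d : nat) (M : phase_mesh R d) (w : R)
    (f g : 'rV[R]_d * 'rV[R]_d -> R) (E : 'rV[R]_d -> 'rV[R]_d) (q : 'rV[R]_d -> R) K :
  vanishes_at_boundary M f ->
  (forall K L x v, closed_cell (Tx K) x -> closed_cell (Tv L) v ->
     trace (M := M) K L g (x, v) = q v) ->
  \sum_L v_boundary (M := M) w f E g K L = 0.
Proof.
move=> f0 gq.
have bd L : v_boundary w f E g K L =
    \sum_(i < facets (Tv L)) \sum_(L' : Iv M)
      \sum_(j < facets (Tv L') | normal (Tv L') j == - normal (Tv L) i)
        v_interface (M := M) w f g E K i j.
  apply: eq_bigr => i _; rewrite [X in _ + X](_ : _ = 0) ?addr0//.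
  rewrite (eq_Rintegral _ (g := fun=> 0)).
    by rewrite /Rintegral integral0.
  move=> x /set_mem Kx; rewrite (eq_Rintegral _ (g := fun=> 0)).
    by rewrite /Rintegral integral0.
  move=> v /set_mem [[Lv _] Ov]; rewrite f0// ?numerical_fluxE.
    by rewrite addr0 subr0 !(mul0r, mulr0) addr0 mul0r.
  by move=> a; exact/ltW/Kx.
under eq_bigr do rewrite bd.
apply: (@antisymmetric_facet_sum _ _ (fun L => facets (Tv L))
  (fun L L' i j => normal (Tv L') j == - normal (Tv L) i)
  (fun L L' i j => v_interface (M := M) w f g E K i j)) => [L L' i j|L L' i j /eqP nij].
  by apply/eqP/eqP => ->; rewrite opprK.
exact: v_flux_antisym gq nij.
Qed.

(** * Fubini on products, and decomposition of the domain into elements *)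

(** The extended-real theorem is applied to the extension of [h] by zero. The inner real integral
    agrees with the extended one where the section is integrable, that is, for almost every [x]. *)
Lemma Rintegral_Fubini (R : realType) d1 d2 (T1 : measurableType d1)
    (T2 : measurableType d2) (m1 : {sigma_finite_measure set T1 -> \bar R})
    (m2 : {sigma_finite_measure set T2 -> \bar R}) (A : set T1) (B : set T2)
    (h : T1 * T2 -> R) :
  measurable A -> measurable B ->
  (m1 \x m2)%E.-integrable (A `*` B) (EFin \o h) ->
  [/\ {ae m1, forall x, A x -> m2.-integrable B (fun y => (h (x, y))%:E)},
      m1.-integrable A (fun x => (\int[m2]_(y in B) h (x, y))%:E) &
      \int[(m1 \x m2)%E]_(z in A `*` B) h z =
      \int[m1]_(x in A) \int[m2]_(y in B) h (x, y)].
Proof.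
move=> mA mB; rewrite integrable_mkcond; last exact: measurableX.
set h' := _ \_ _ => ih'.
have h'E x : A x -> (fun y => h' (x, y)) = (fun y => (h (x, y))%:E) \_ B.
  move=> Ax; apply/funext => y; rewrite /h' /patch /=.
  by congr (if _ then _ else _); apply/idP/idP; rewrite !inE// => -[].
have FE x : A x -> fubini_F m2 h' x = (\int[m2]_(y in B) (h (x, y))%:E)%E.
  by move=> Ax; rewrite /fubini_F h'E// -integral_mkcond.
have aeB : {ae m1, forall x, A x -> m2.-integrable B (fun y => (h (x, y))%:E)}.
  apply: filterS (ae_integrable1 ih') => x + Ax.
  by rewrite h'E// -integrable_mkcond.
have iF : m1.-integrable A (fubini_F m2 h').
  exact: integrableS (integrable_fubini_F ih').
have aeF : ae_eq m1 A (fubini_F m2 h') (fun x => (\int[m2]_(y in B) h (x, y))%:E).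
  apply: filterS aeB => x + Ax => /(_ Ax) iB; rewrite FE// fineK//.
  exact: integrable_fin_num.
(* Measurability does not follow from almost everywhere equality; it comes from the exact expression
   as [fine] of a measurable function. *)
have mG : measurable_fun A (fun x => (\int[m2]_(y in B) h (x, y))%:E).
  rewrite /Rintegral; apply/measurable_EFinP.
  apply: (eq_measurable_fun (fine \o fubini_F m2 h')).
    by move=> x /set_mem Ax; rewrite /= FE.
  apply: measurableT_comp; [exact: fine_measurable|exact: measurable_int iF].
split=> //.
  apply/integrableP; split => //; have /integrableP[mF] := iF.
  rewrite (ae_eq_integral (abse \o fubini_F m2 h') _ _ _ _ (ae_eq_abse (ae_eq_sym aeF)))//.
  - exact: measurableT_comp.
  - exact: measurableT_comp.
rewrite {1}/Rintegral integral_mkcond.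
rewrite -[X in integral _ _ X]/h' -integral12_prod_meas1//.
rewrite [RHS]/Rintegral; congr fine.
rewrite -(ae_eq_integral _ _ _ _ _ aeF)//; last exact: measurable_int iF.
rewrite [RHS]integral_mkcond; apply: eq_integral => x _.
rewrite /patch; case: ifPn => // /negP xA; apply: integral0_eq => y _.
rewrite /h' /patch; case: ifPn => // /set_mem -[/= Ax _]; case: xA; exact: mem_set.
Qed.

Lemma measurable_mesh_domain (R : realType) (d : nat) (I : finType)
    (T : I -> polytope R d) :
  measurable (mesh_domain T).
Proof.
by apply: fin_bigcup_measurable => // K _; exact: measurable_closed_cell.
Qed.

Lemma mesh_domain_bounded (R : realType) (d : nat) (I : finType)
    (T : I -> polytope R d) :
  is_mesh T -> exists C, forall x, mesh_domain T x -> forall i, `|x ord0 i| <= C.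
Proof.
move=> [mT _]; have /choice[C hC] := fun K => closed_cell_bounded (mT K).
exists (\sum_K `|C K|) => x [K _ Kx] i; apply: le_trans (hC K x Kx i) _.
by rewrite (bigD1 K)//= (le_trans (ler_norm _))// lerDl sumr_ge0.
Qed.

Lemma lebesgue_mesh_domain (R : realType) (d : nat) (I : finType)
    (T : I -> polytope R d) :
  is_mesh T -> (lebesgue_rV d (mesh_domain T) < +oo)%E.
Proof.
move=> /mesh_domain_bounded[C hC].
by apply: lebesgue_rV_bounded hC; exact: measurable_mesh_domain.
Qed.

Lemma cell_sub_mesh_domain (R : realType) (d : nat) (I : finType)
    (T : I -> polytope R d) K :
  cell (T K) `<=` mesh_domain T.
Proof. by move=> x Kx; exists K => // i; exact/ltW/Kx. Qed.

Definition cell_union (R : realType) (d : nat) (I : finType)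
    (T : I -> polytope R d) :=
  \bigcup_(K in [set: I]) cell (T K).

Lemma measurable_cell_union (R : realType) (d : nat) (I : finType)
    (T : I -> polytope R d) :
  measurable (cell_union T).
Proof. by apply: fin_bigcup_measurable => // K _; exact: measurable_cell. Qed.

Lemma negligible_fin_bigcup d (T : measurableType d) (R : realType)
    (mu : {measure set T -> \bar R}) (I : finType) (F : I -> set T) :
  (forall i, mu.-negligible (F i)) -> mu.-negligible (\bigcup_(i in [set: I]) F i).
Proof.
move=> F0; rewrite (_ : \bigcup_(_ in _) _ = \big[setU/set0]_(i <- index_enum I) F i).
  elim: (index_enum I) => [|i s IH]; first by rewrite big_nil; exact: negligible_set0.
  by rewrite big_cons; exact: negligibleU.
rewrite -bigcup_seq; apply: eq_bigcupl; split => i //= _.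
exact: mem_index_enum.
Qed.

(** A point of a closed cell outside the open one attains equality in some facet constraint, so the
    set lies in finitely many hyperplanes. *)
Lemma lebesgue_skeleton (R : realType) (d : nat) (I : finType)
    (T : I -> polytope R d) :
  is_mesh T -> lebesgue_rV d (mesh_domain T `\` cell_union T) = 0%E.
Proof.
move=> [mT _]; apply: measure_negligible.
  by apply: measurableD; [exact: measurable_mesh_domain|exact: measurable_cell_union].
apply: (@negligibleS _ _ _ _ (\bigcup_(K in [set: I]) \bigcup_(i in [set: 'I_(facets (T K))])
    [set x | dot (normal (T K) i) x = offset (T K) i])).
  move=> x [[K _ Kx] Ux]; exists K => //; apply: contrapT => nK; apply: Ux.
  exists K => // i; rewrite lt_neqAle Kx andbT; apply/eqP => ix; apply: nK.
  by exists i.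
apply: negligible_fin_bigcup => K; apply: negligible_fin_bigcup => i.
apply/negligibleP; first exact: measurable_hyperplane.
apply: lebesgue_rV_hyperplane; apply: contra_eq_neq (is_mesh_cell_unit_normals (mT K) i) => ->.
by rewrite /dot big1 ?oner_neq0 // => [|a _]; [rewrite eq_sym oner_eq0|rewrite mxE mul0r].
Qed.

Local Notation leb2 d := (lebesgue_rV d \x lebesgue_rV d)%E.

Lemma measurable_Omega (R : realType) (d : nat) (M : phase_mesh R d) :
  measurable (Omega M).
Proof. by apply: measurableX; exact: measurable_mesh_domain. Qed.

Lemma measurable_element (R : realType) (d : nat) (M : phase_mesh R d) K L :
  measurable (element (M := M) K L).
Proof. by apply: measurableX; exact: measurable_cell. Qed.

Lemma element_sub_Omega (R : realType) (d : nat) (M : phase_mesh R d) K L :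
  element (M := M) K L `<=` Omega M.
Proof.
move=> z [Kz Lz]; split.
  exact: (@cell_sub_mesh_domain _ _ _ (@Tx _ _ M) K).
exact: (@cell_sub_mesh_domain _ _ _ (@Tv _ _ M) L).
Qed.

Lemma sum_element (R : realType) (d : nat) (M : phase_mesh R d)
    (h : 'rV[R]_d * 'rV[R]_d -> R) :
  is_mesh (@Tx _ _ M) -> is_mesh (@Tv _ _ M) ->
  (leb2 d).-integrable (Omega M) (EFin \o h) ->
  \sum_K \sum_L \int[leb2 d]_(z in element (M := M) K L) h z =
  \int[leb2 d]_(z in Omega M) h z.
Proof.
move=> mx mv ih.
pose F (p : Ix M * Iv M) := element p.1 p.2.
pose U := cell_union (@Tx _ _ M) `*` cell_union (@Tv _ _ M).
have mU : measurable U by apply: measurableX; exact: measurable_cell_union.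
have UE : \big[setU/set0]_(p <- index_enum (Ix M * Iv M)%type) F p = U.
  rewrite -bigcup_seq; apply/seteqP; split => z.
    by move=> [[K L] _ [Kz Lz]]; split; [exists K|exists L].
  by move=> [[K _ Kz] [L _ Lz]]; exists (K, L) => //=; exact: mem_index_enum.
(* A point outside all elements has its [x] or its [v] on a skeleton; a strip over a null set is
   null, since zero times infinity is zero. *)
have U0 : (leb2 d) (Omega M `\` U) = 0%E.
  apply: measure_negligible; first by apply: measurableD => //; exact: measurable_Omega.
  apply: (@negligibleS _ _ _ _
    (((Omega_x M `\` cell_union (@Tx _ _ M)) `*` setT) `|`
     (setT `*` (Omega_v M `\` cell_union (@Tv _ _ M))))).
    move=> z [[Oz1 Oz2] Uz].
    have [Uz1|Uz1] := pselect (cell_union (@Tx _ _ M) z.1); last by left.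
    by right; split => //; split => // Uz2; exact: Uz.
  have mX : measurable (Omega_x M `\` cell_union (@Tx _ _ M)).
    by apply: measurableD; [exact: measurable_mesh_domain|exact: measurable_cell_union].
  have mV : measurable (Omega_v M `\` cell_union (@Tv _ _ M)).
    by apply: measurableD; [exact: measurable_mesh_domain|exact: measurable_cell_union].
  apply: negligibleU; apply/negligibleP; try exact: measurableX.
    by apply: etrans (product_measure1E _ _ mX measurableT) _;
      rewrite [X in (X * _)%E](lebesgue_skeleton mx) mul0e.
  by apply: etrans (product_measure1E _ _ measurableT mV) _;
    rewrite [X in (_ * X)%E](lebesgue_skeleton mv) mule0.
have mF p : measurable (F p) by exact: measurable_element.
have FO p : F p `<=` Omega M by exact: element_sub_Omega.
rewrite [RHS]/Rintegral (negligible_integral _ _ ih U0)//; last 2 first.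
- by apply: measurableD => //; exact: measurable_Omega.
- exact: measurable_Omega.
have UO : U `<=` Omega M by move=> z [[K _ Kz] [L _ Lz]]; exact: (@FO (K, L)).
rewrite setDD setIidr//.
rewrite -UE integral_bigsetU_EFin//; last 3 first.
- exact: index_enum_uniq.
- move=> [K L] [K' L'] _ _ [z [[/= Kz Lz] [/= Kz' Lz']]]; congr pair; apply/eqP.
    apply: contraT => /(mx.2) /seteqP[/(_ z.1) + _]; by move=> /(_ (conj Kz Kz')).
  apply: contraT => /(mv.2) /seteqP[/(_ z.2) + _]; by move=> /(_ (conj Lz Lz')).
- rewrite UE; apply: measurable_funS (measurable_int _ ih) => //; exact: measurable_Omega.
rewrite pair_bigA /= -sum_fine//.
move=> p _; apply: integrable_fin_num; first exact: mF.
by apply: integrableS ih => //; exact: measurable_Omega.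
Qed.

(** * Integrable and square integrable functions *)

Lemma integrable_ae_eq d (T : measurableType d) (R : realType)
    (mu : {measure set T -> \bar R}) (D : set T) (f g : T -> \bar R) :
  measurable D -> measurable_fun D g -> ae_eq mu D f g ->
  mu.-integrable D f -> mu.-integrable D g.
Proof.
move=> mD mg fg /integrableP[mf foo]; apply/integrableP; split => //.
rewrite -(ae_eq_integral _ _ _ _ _ (ae_eq_abse fg))//; exact: measurableT_comp.
Qed.

Lemma Rintegral_sum d (T : measurableType d) (R : realType)
    (mu : {measure set T -> \bar R}) (D : set T) (I : Type) (s : seq I) (f : I -> T -> R) :
  measurable D -> (forall i, mu.-integrable D (EFin \o f i)) ->
  \int[mu]_(x in D) (\sum_(i <- s) f i x) = \sum_(i <- s) \int[mu]_(x in D) f i x.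
Proof.
move=> mD fi; elim: s => [|i s IH].
  rewrite big_nil (eq_Rintegral _ (g := fun=> 0)); last by move=> x _; rewrite big_nil.
  by rewrite /Rintegral integral0.
rewrite big_cons -IH -RintegralD//.
  by apply: eq_Rintegral => x _; rewrite big_cons.
rewrite (_ : _ \o _ = fun x => (\sum_(i <- s) (f i x)%:E)%E).
  by apply: integrable_sum => // j _; exact: fi.
by apply/funext => x; rewrite /= sumEFin.
Qed.

(** Domination by |f g| <= f^2 + g^2. *)
Lemma square_integrableM disp (T : measurableType disp) (R : realType)
    (mu : {measure set T -> \bar R}) (D : set T) (f g : T -> R) :
  measurable D -> square_integrable mu D f -> square_integrable mu D g ->
  mu.-integrable D (fun x => (f x * g x)%:E).
Proof.
move=> mD [mf fi] [mg gi].
apply: (@le_integrable _ _ _ _ _ _ _ (fun x => (f x ^+ 2)%:E + (g x ^+ 2)%:E)%E) => //.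
- by apply/measurable_EFinP; exact: measurable_funM.
- move=> x _; rewrite -EFinD lee_fin normrM.
  rewrite [leRHS]ger0_norm ?addr_ge0 ?sqr_ge0// -(real_normK (num_real (f x))).
  rewrite -(real_normK (num_real (g x))).
  by have := sqr_ge0 (`|f x| - `|g x|); have := sqr_ge0 (`|f x| + `|g x|); nra.
- exact: integrableD.
Qed.

Lemma square_integrableD disp (T : measurableType disp) (R : realType)
    (mu : {measure set T -> \bar R}) (D : set T) (f g : T -> R) (c : R) :
  measurable D -> square_integrable mu D f -> square_integrable mu D g ->
  square_integrable mu D (fun x => f x + c * g x).
Proof.
move=> mD sf sg; have [mf fi] := sf; have [mg gi] := sg; split.
  by apply: measurable_funD => //; exact: measurable_funM.
rewrite (_ : (fun x => _) = (fun x => (f x ^+ 2)%:E + ((2 * c)%:E * (f x * g x)%:E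
    + (c ^+ 2)%:E * (g x ^+ 2)%:E))%E); last first.
  by apply/funext => x; rewrite -!EFinM -!EFinD; congr (_%:E); ring.
apply: integrableD => //; apply: integrableD => //; apply: integrableZl => //.
exact: square_integrableM.
Qed.

Lemma square_integrable_bounded disp (T : measurableType disp) (R : realType)
    (mu : {measure set T -> \bar R}) (D : set T) (f h : T -> R) (C : R) :
  measurable D -> square_integrable mu D f -> measurable_fun D h ->
  (forall x, D x -> `|h x| <= C) -> square_integrable mu D (fun x => f x * h x).
Proof.
move=> mD [mf fi] mh hC; split; first exact: measurable_funM.
apply: (@le_integrable _ _ _ _ _ _ _ (fun x => (C ^+ 2)%:E * (f x ^+ 2)%:E)%E) => //.
- by apply/measurable_EFinP/measurable_funX; exact: measurable_funM.
- move=> x Dx; rewrite -EFinM lee_fin exprMn [leLHS]normrM mulrC [leRHS]normrM ler_wpM2r//.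
  by rewrite !normrX lerXn2r ?nnegrE// (le_trans (hC x Dx))// ler_norm.
- exact: integrableZl.
Qed.

Lemma square_integrable_cst disp (T : measurableType disp) (R : realType)
    (mu : {measure set T -> \bar R}) (D : set T) (c : R) :
  measurable D -> (mu D < +oo)%E -> square_integrable mu D (cst c).
Proof.
move=> mD Doo; split => //; apply: measurable_bounded_integrable => //.
  exact: (measurable_funX _ (measurable_cst c)).
exists `|c ^+ 2|; split => [|b cb x _ /=]; first exact: num_real.
exact: ltW.
Unshelve. all: by end_near. Qed.

(** By Tonelli the integral of |h| over the product is [m2 B] times the one over [A]. *)
Lemma integrable_fst (R : realType) d1 d2 (T1 : measurableType d1)
    (T2 : measurableType d2) (m1 : {sigma_finite_measure set T1 -> \bar R})
    (m2 : {sigma_finite_measure set T2 -> \bar R}) (A : set T1) (B : set T2)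
    (h : T1 -> R) :
  measurable A -> measurable B -> (m2 B < +oo)%E ->
  m1.-integrable A (EFin \o h) ->
  (m1 \x m2)%E.-integrable (A `*` B) (fun z => (h z.1)%:E).
Proof.
move=> mA mB Boo ih; have mAB := measurableX mA mB.
apply/integrable_mkcond => //; apply/integrable12ltyP.
  apply/(measurable_restrictT _ _).1 => //; apply/measurable_EFinP.
  move=> _ Y mY; rewrite (_ : _ `&` _ = (A `&` h @^-1` Y) `*` B).
    by apply: measurableX => //; have /measurable_EFinP := measurable_int _ ih; exact.
  by apply/seteqP; split => z [] => [[? ?] ?|[? ?] ?].
rewrite (_ : integral _ _ _ = (\int[m1]_(x in A) (`|h x|%:E * m2 B))%E).
  rewrite ge0_integralZr//; last first.
    apply/measurable_EFinP; apply: measurableT_comp => //.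
    by apply/measurable_EFinP; exact: (measurable_int _ ih).
  by rewrite lte_mul_pinfty ?integral_ge0// ge0_fin_numE ?integral_ge0//;
    have /integrableP[] := ih.
rewrite [RHS]integral_mkcond; apply: eq_integral => x _.
rewrite /patch; case: ifPn => xA; last first.
  apply: integral0_eq => y _; case: ifPn; last by rewrite abse0.
  by move=> /set_mem[/= Ax _]; rewrite (mem_set Ax) in xA.
rewrite -integral_cst// [RHS]integral_mkcond; apply: eq_integral => y _.
rewrite /patch (_ : ((x, y) \in A `*` B) = (y \in B)); first by case: ifP; rewrite ?abse0.
apply/idP/idP => /set_mem; first by case=> _ By; exact: mem_set.
by move=> By; apply: mem_set; split => //; exact: set_mem.
Qed.

(** * The test function |v|^2 *)

(** This is where [2 <= k] enters: [e i] is the exponent vector of the monomial v_i^2, and the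
    coefficients are the indicators of these vectors. *)
Lemma sumsq_polynomial (R : realType) (d k : nat)
    (D : set ('rV[R]_d * 'rV[R]_d)) :
  (2 <= k)%N -> polynomial_on k D (fun z => dot z.2 z.2).
Proof.
move=> k2; pose e (i : 'I_d) : {ffun 'I_(d + d) -> 'I_k.+1} :=
  [ffun t => if t == rshift d i then inord 2 else inord 0].
have eE i t : e i t = (if t == rshift d i then 2%N else 0%N) :> nat.
  by rewrite ffunE; case: ifP => _; rewrite inordK// ltnS.
have edeg i : (\sum_t e i t <= k)%N.
  rewrite (bigD1 (rshift d i))//= eE eqxx big1 ?addn0// => t /negPf ti.
  by rewrite eE ti.
exists (fun a => \sum_i (a == e i)%:R) => z _.
under eq_bigr do rewrite mulr_suml.
rewrite exchange_big/=; apply: eq_bigr => i _.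
rewrite (bigD1 (e i))//= [X in _ + X]big1 ?addr0; last first.
  by move=> a /andP[_ /negPf ->]; rewrite mul0r.
rewrite eqxx mul1r (bigD1 (rshift d i))//= eE eqxx row_mxEr big1 ?mulr1 ?expr2//.
by move=> t /negPf ti; rewrite eE ti expr0.
Qed.

Lemma dot_delta (R : realType) (d : nat) (i : 'I_d) (u : 'rV[R]_d) :
  dot (delta_mx ord0 i) u = u ord0 i.
Proof.
rewrite /dot (bigD1 i)//= mxE !eqxx mul1r big1 ?addr0// => j /negPf ji.
by rewrite mxE ji andbF mul0r.
Qed.

Lemma grad_x_sumsq (R : realType) (d : nat) (z : 'rV[R]_d * 'rV[R]_d) :
  grad_x (fun z => dot z.2 z.2) z = 0.
Proof. by apply/rowP => i; rewrite !mxE /=; exact: derive_cst. Qed.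

Lemma grad_v_sumsq (R : realType) (d : nat) (z : 'rV[R]_d * 'rV[R]_d) :
  grad_v (fun z => dot z.2 z.2) z = 2 *: z.2.
Proof.
apply/rowP => i; rewrite !mxE /=; apply: cvg_lim => //.
(* The difference quotient of |v|^2 in the i-th direction is exactly 2 v_i + h. *)
have h0 : 2 * z.2 ord0 i + h @[h --> (0 : R)^'] --> 2 * z.2 ord0 i.
  rewrite -[X in _ --> X]addr0; apply: cvgD; first exact: cvg_cst.
  by apply: cvg_within_filter; exact: cvg_id.
apply: cvg_trans h0; apply: near_eq_cvg; near=> h.
have hn0 : h != 0 by near: h; exact: nbhs_dnbhs_neq.
rewrite /= !dotDl !dotDr !dotZl !dotZr (dotC z.2) !dot_delta mxE !eqxx /=.
by rewrite /GRing.scale /=; field.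
Unshelve. all: by end_near. Qed.

Lemma lebesgue_Omega (R : realType) (d : nat) (M : phase_mesh R d) :
  is_phase_mesh M -> ((lebesgue_rV d \x lebesgue_rV d) (Omega M) < +oo)%E.
Proof.
move=> [mx mv _]; rewrite /Omega.
apply: (@le_lt_trans _ _ (lebesgue_rV d (Omega_x M) * lebesgue_rV d (Omega_v M))%E).
  by rewrite product_measure1E//; exact: measurable_mesh_domain.
rewrite lte_mul_pinfty//; last exact: lebesgue_mesh_domain.
by rewrite ge0_fin_numE//; exact: lebesgue_mesh_domain.
Qed.

Lemma measurable_snd_dot (R : realType) (d : nat)
    (D : set ('rV[R]_d * 'rV[R]_d)) :
  measurable_fun D (fun z : 'rV[R]_d * 'rV[R]_d => dot z.2 z.2).
Proof.
apply: measurable_funTS; apply: measurable_sum => i; apply: measurable_funM;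
  exact: measurableT_comp (measurable_rV_coord i) measurable_snd.
Qed.

Lemma measurable_snd_coord (R : realType) (d : nat)
    (D : set ('rV[R]_d * 'rV[R]_d)) i :
  measurable_fun D (fun z : 'rV[R]_d * 'rV[R]_d => z.2 ord0 i).
Proof.
apply: measurable_funTS.
exact: measurableT_comp (measurable_rV_coord i) measurable_snd.
Qed.

Lemma Omega_bounded (R : realType) (d : nat) (M : phase_mesh R d) :
  is_phase_mesh M -> exists C, forall z, Omega M z ->
    (forall i, `|z.2 ord0 i| <= C) /\ `|dot z.2 z.2| <= C.
Proof.
move=> [_ /mesh_domain_bounded[C hC] _].
exists (`|C| + \sum_(i < d) `|C| * `|C|) => z [_ /hC zC].
have zC' i : `|z.2 ord0 i| <= `|C| by rewrite (le_trans (zC i))// ler_norm.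
split=> [i|]; first by rewrite (le_trans (zC' i))// lerDl sumr_ge0.
apply: le_trans (ler_norm_sum _ _ _) _; rewrite -[leLHS]add0r lerD// ler_sum// => i _.
by rewrite normrM ler_pM.
Qed.

Lemma square_integrable_Omega_bounded (R : realType) (d : nat)
    (M : phase_mesh R d)
    (h : 'rV[R]_d * 'rV[R]_d -> R) (C : R) :
  is_phase_mesh M -> measurable_fun (Omega M) h ->
  (forall z, Omega M z -> `|h z| <= C) ->
  square_integrable (leb2 d) (Omega M) h.
Proof.
move=> hM mh hC; rewrite (_ : h = fun z => cst 1 z * h z); last first.
  by apply/funext => z; rewrite mul1r.
apply: (square_integrable_bounded (C := C)) => //; first exact: measurable_Omega.
by apply: square_integrable_cst; [exact: measurable_Omega|exact: lebesgue_Omega].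
Qed.

Lemma sumsq_dg_space (R : realType) (d : nat) (M : phase_mesh R d) k :
  is_phase_mesh M -> (2 <= k)%N -> dg_space M k (fun z => dot z.2 z.2).
Proof.
move=> hM k2; split => [|K L]; last exact: sumsq_polynomial.
have [C hC] := Omega_bounded hM.
apply: (@square_integrable_Omega_bounded _ _ _ _ C) => // [|z /hC[]//].
exact: measurable_snd_dot.
Qed.

Lemma continuous_sumsq (R : realType) (d : nat) :
  continuous (fun z : 'rV[R]_d * 'rV[R]_d => dot z.2 z.2).
Proof.
apply: (@continuous_big _ _ (+%R : R -> R -> R) 0 _ _ _ _
  (fun i (z : 'rV[R]_d * 'rV[R]_d) => z.2 ord0 i * z.2 ord0 i)) => [|i _ z].
  exact: add_continuous.
suff c : {for z, continuous (fun z : 'rV[R]_d * 'rV[R]_d => z.2 ord0 i)} by exact: cvgM.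
apply: (@continuous_comp _ _ _ snd (fun x : 'rV[R]_d => x ord0 i)); first exact: cvg_snd.
exact: coord_continuous.
Qed.

(** * Kinetic energy, current and work of the field *)

Lemma integrable_kinetic (R : realType) (d : nat) (M : phase_mesh R d)
    (f : 'rV[R]_d * 'rV[R]_d -> R) :
  is_phase_mesh M ->
  square_integrable (leb2 d) (Omega M) f ->
  (leb2 d).-integrable (Omega M)
    (fun z => (f z * dot z.2 z.2)%:E).
Proof.
move=> hM sf; apply: square_integrableM => //; first exact: measurable_Omega.
have [C hC] := Omega_bounded hM.
apply: (@square_integrable_Omega_bounded _ _ _ _ C) => // [|z /hC[]//].
exact: measurable_snd_dot.
Qed.

Lemma kineticE (R : realType) (d : nat) (M : phase_mesh R d)
    (f : 'rV[R]_d * 'rV[R]_d -> R) :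
  is_phase_mesh M ->
  square_integrable (leb2 d) (Omega M) f ->
  \int[leb2 d]_(z in Omega M) (f z * dot z.2 z.2) = kinetic M f.
Proof.
move=> hM /(integrable_kinetic hM) fi.
by have [_ _] := Rintegral_Fubini (measurable_mesh_domain (@Tx _ _ M))
  (measurable_mesh_domain (@Tv _ _ M)) fi.
Qed.

(** As [v] is bounded on [Omega_v], f v_i is integrable on [Omega], and Fubini applies. Linearity of
    the current may be used only at the points [x] of the first conclusion. *)
Lemma integrable_current (R : realType) (d : nat) (M : phase_mesh R d)
    (f : 'rV[R]_d * 'rV[R]_d -> R) i :
  is_phase_mesh M ->
  square_integrable (leb2 d) (Omega M) f ->
  {ae lebesgue_rV d, forall x, Omega_x M x ->
     (lebesgue_rV d).-integrable (Omega_v M) (fun v => (f (x, v) * v ord0 i)%:E)} /\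
  measurable_fun (Omega_x M) (fun x => current M f x ord0 i).
Proof.
move=> hM sf.
have fi : (leb2 d).-integrable (Omega M)
    (fun z => (f z * z.2 ord0 i)%:E).
  apply: square_integrableM => //; first exact: measurable_Omega.
  have [C hC] := Omega_bounded hM.
  apply: (@square_integrable_Omega_bounded _ _ _ _ C) => // [|z /hC[]//].
  exact: measurable_snd_coord.
have [ae1 iJ _] := Rintegral_Fubini (measurable_mesh_domain (@Tx _ _ M))
  (measurable_mesh_domain (@Tv _ _ M)) fi.
split => //; apply/measurable_EFinP; under eq_fun do rewrite mxE.
exact: measurable_int iJ.
Qed.

(** E_i(x) v_i is square integrable on [Omega], since [v] is bounded and [Omega_v] has finite
    measure. After Fubini, E_i(x) is pulled out of the inner integral for almost every [x]. *)
Lemma field_moment (R : realType) (d : nat) (M : phase_mesh R d)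
    (f : 'rV[R]_d * 'rV[R]_d -> R) (E : 'rV[R]_d -> 'rV[R]_d) i :
  is_phase_mesh M ->
  square_integrable (leb2 d) (Omega M) f -> field M E ->
  [/\ (leb2 d).-integrable (Omega M)
        (fun z => (f z * (E z.1 ord0 i * z.2 ord0 i))%:E),
      (lebesgue_rV d).-integrable (Omega_x M)
        (fun x => (E x ord0 i * current M f x ord0 i)%:E) &
      \int[leb2 d]_(z in Omega M)
        (f z * (E z.1 ord0 i * z.2 ord0 i)) =
      \int[lebesgue_rV d]_(x in Omega_x M) (E x ord0 i * current M f x ord0 i)].
Proof.
move=> hM sf fE; have [mx mv _] := hM.
have mOx := measurable_mesh_domain (@Tx _ _ M).
have mOv := measurable_mesh_domain (@Tv _ _ M).
have mO := measurable_Omega M.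
have [C hC] := Omega_bounded hM.
have fi : (leb2 d).-integrable (Omega M)
    (fun z => (f z * (E z.1 ord0 i * z.2 ord0 i))%:E).
  apply: square_integrableM => //.
  apply: (square_integrable_bounded (C := C)) => //.
  - have [mE iE] := fE i; split.
      move=> _ Y mY; rewrite (_ : _ `&` _ =
          (Omega_x M `&` (fun x => E x ord0 i) @^-1` Y) `*` Omega_v M).
        by apply: measurableX => //; exact: mE.
      by apply/seteqP; split => z [] => [[? ?] ?|[? ?] ?].
    apply: (integrable_fst (h := fun x => E x ord0 i ^+ 2)) => //.
    exact: lebesgue_mesh_domain.
  - exact: measurable_snd_coord.
  - by move=> z /hC[].
have [ae1 mJ] := integrable_current i hM sf.
have [_ iF FE] := Rintegral_Fubini mOx mOv fi.
have aeq : ae_eq (lebesgue_rV d) (Omega_x M)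
    (fun x => (\int[lebesgue_rV d]_(v in Omega_v M)
      (f (x, v) * (E x ord0 i * v ord0 i)))%:E)
    (fun x => (E x ord0 i * current M f x ord0 i)%:E).
  apply: filterS ae1 => x + Ox => /(_ Ox) iv; congr (_%:E).
  rewrite mxE -RintegralZl//; apply: eq_Rintegral => v _; exact: mulrCA.
have mEJ : measurable_fun (Omega_x M) (fun x => (E x ord0 i * current M f x ord0 i)%:E).
  by apply/measurable_EFinP; apply: measurable_funM => //; have [] := fE i.
split => //; first exact: integrable_ae_eq aeq iF.
rewrite FE /Rintegral; congr fine.
by apply: ae_eq_integral => //; exact: measurable_int iF.
Qed.

Lemma field_moments (R : realType) (d : nat) (M : phase_mesh R d)
    (f : 'rV[R]_d * 'rV[R]_d -> R) (E : 'rV[R]_d -> 'rV[R]_d) :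
  is_phase_mesh M ->
  square_integrable (leb2 d) (Omega M) f -> field M E ->
  (leb2 d).-integrable (Omega M)
    (fun z => (f z * dot (E z.1) z.2)%:E) /\
  \int[leb2 d]_(z in Omega M) (f z * dot (E z.1) z.2) =
  field_product M E (current M f).
Proof.
move=> hM sf fE; have h i := field_moment i hM sf fE.
have mO := measurable_Omega M.
have mOx := measurable_mesh_domain (@Tx _ _ M).
have e : (fun z : 'rV[R]_d * 'rV[R]_d => f z * dot (E z.1) z.2) =
    (fun z => \sum_(i < d) f z * (E z.1 ord0 i * z.2 ord0 i)).
  by apply/funext => z; rewrite /dot mulr_sumr.
split.
  rewrite (_ : (fun z => _) = (fun z => (\sum_(i < d)
      (f z * (E z.1 ord0 i * z.2 ord0 i))%:E)%E)).
    by apply: integrable_sum => // i _; have [] := h i.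
  by apply/funext => z; rewrite sumEFin /dot mulr_sumr.
rewrite e Rintegral_sum//; last by move=> i; have [] := h i.
rewrite /field_product /dot Rintegral_sum//; last by move=> i; have [] := h i.
by apply: eq_bigr => i _; have [] := h i.
Qed.

(** The kinetic half of the balance, common to all schemes: [f] and [E] are arbitrary stage values
    and [tau] may be negative. *)
Lemma transport_energy (R : realType) (d k : nat) (M : phase_mesh R d) fl
    (tau : R)
    (f0 f1 f : 'rV[R]_d * 'rV[R]_d -> R) (E : 'rV[R]_d -> 'rV[R]_d) :
  is_phase_mesh M -> (2 <= k)%N -> tau != 0 ->
  dg_space M k f0 -> dg_space M k f1 -> Defs.approximation M k f -> field M E ->
  transport_step M k fl tau f0 f1 f E ->
  kinetic M f1 - kinetic M f0 = 2 * tau * field_product M E (current M f).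
Proof.
move=> hM k2 t0 [sf0 _] [sf1 _] [[sf pf] f_bd] fE step; have [mx mv _] := hM.
have mO := measurable_Omega M.
set w := jump_weight fl tau in step.
pose g (z : 'rV[R]_d * 'rV[R]_d) := dot z.2 z.2.
have gq K L x v : closed_cell (Tx K) x -> closed_cell (Tv L) v ->
    trace (M := M) K L g (x, v) = dot v v.
  move=> Kx Lv; rewrite (@trace_eq _ _ _ _ _ _ g (x, v) (mx.1 K) (mv.1 L))//.
  exact: continuous_sumsq.
have BKE K L : BK w f E g K L =
    - 2 * (\int[leb2 d]_(z in element (M := M) K L) (f z * dot (E z.1) z.2))
    + x_boundary w f g K L + v_boundary w f E g K L.
  rewrite /BK; congr (_ + _ + _).
  rewrite (eq_Rintegral _ (g := fun=> 0)); last first.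
    by move=> z _; rewrite grad_x_sumsq /dot big1 ?mulr0// => i _; rewrite mxE mulr0.
  rewrite {1}/Rintegral integral0 /= oppr0 add0r mulNr; congr (- _).
  rewrite -RintegralZl//; last 2 first.
  - exact: measurable_element.
  - apply: integrableS (field_moments hM sf fE).1 => //; first exact: measurable_element.
    exact: element_sub_Omega.
  by apply: eq_Rintegral => z _; rewrite grad_v_sumsq dotZr; ring.
have xb0 : \sum_K \sum_L x_boundary (M := M) w f g K L = 0.
  by rewrite exchange_big big1//= => L _; exact: (sum_x_boundary w _ mx mv pf gq).
have vb0 : \sum_K \sum_L v_boundary (M := M) w f E g K L = 0.
  by rewrite big1//= => K _; exact: (sum_v_boundary w E _ f_bd gq).
have i0 := integrable_kinetic hM sf0; have i1 := integrable_kinetic hM sf1.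
have H1 : \int[leb2 d]_(z in Omega M)
    ((f1 z - f0 z) / tau * g z) = tau^-1 * (kinetic M f1 - kinetic M f0).
  rewrite -!kineticE// -RintegralB// -RintegralZl//.
    by apply: eq_Rintegral => z _; rewrite /g; ring.
  rewrite (_ : _ \o _ = (fun z => (f1 z * dot z.2 z.2)%:E - (f0 z * dot z.2 z.2)%:E)%E).
    exact: integrableB.
  by apply/funext.
have i10 : (leb2 d).-integrable (Omega M)
    (EFin \o (fun z => (f1 z - f0 z) / tau * g z)).
  rewrite (_ : _ \o _ = (fun z => (tau^-1)%:E * ((f1 z * g z)%:E - (f0 z * g z)%:E))%E).
    by apply: integrableZl => //; exact: integrableB.
  by apply/funext => z /=; rewrite -EFinB -EFinM; congr (_%:E); ring.
have H2 := (field_moments hM sf fE).2.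
have /esym : \sum_K \sum_L (\int[leb2 d]_(z in
    element (M := M) K L) ((f1 z - f0 z) / tau * g z) + BK w f E g K L) = 0.
  rewrite big1// => K _; rewrite big1// => L _; apply: step.
  exact: sumsq_dg_space.
under eq_bigr do under eq_bigr do rewrite BKE !addrA.
under eq_bigr do rewrite !big_split/= -mulr_sumr.
rewrite !big_split/= -mulr_sumr xb0 vb0 !addr0 !sum_element// ?H1 ?H2; last first.
  exact: (field_moments hM sf fE).1.
move/eqP; rewrite mulNr eq_sym subr_eq0 => /eqP /(congr1 ( *%R tau)).
by rewrite mulVKf// => ->; ring.
Qed.

(** * Fields, their bilinear product and the Ampere step *)

Lemma fieldD (R : realType) (d : nat) (M : phase_mesh R d)
    (A B : 'rV[R]_d -> 'rV[R]_d) (c : R) :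
  field M A -> field M B -> field M (fun x => A x + c *: B x).
Proof.
move=> fA fB i; under eq_fun do rewrite !mxE.
exact: square_integrableD (measurable_mesh_domain _) (fA i) (fB i).
Qed.

Lemma integrable_dot (R : realType) (d : nat) (M : phase_mesh R d)
    (A B : 'rV[R]_d -> 'rV[R]_d) :
  field M A -> field M B ->
  (lebesgue_rV d).-integrable (Omega_x M) (fun x => (dot (A x) (B x))%:E).
Proof.
move=> fA fB; rewrite (_ : (fun x => _) = fun x =>
    (\sum_(i < d) (A x ord0 i * B x ord0 i)%:E)%E); last first.
  by apply/funext => x; rewrite sumEFin.
have mO := measurable_mesh_domain (@Tx _ _ M).
by apply: integrable_sum => // i _; exact: square_integrableM.
Qed.

Lemma field_productC (R : realType) (d : nat) (M : phase_mesh R d)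
    (A B : 'rV[R]_d -> 'rV[R]_d) :
  field_product M A B = field_product M B A.
Proof. by apply: eq_Rintegral => x _; exact: dotC. Qed.

Lemma field_productDl (R : realType) (d : nat) (M : phase_mesh R d)
    (A B C : 'rV[R]_d -> 'rV[R]_d) (c : R) :
  field M A -> field M B -> field M C ->
  field_product M (fun x => A x + c *: B x) C = field_product M A C + c * field_product M B C.
Proof.
move=> fA fB fC; have mO := measurable_mesh_domain (@Tx _ _ M).
have iAC := integrable_dot fA fC; have iBC := integrable_dot fB fC.
rewrite /field_product -RintegralZl// -RintegralD//.
  by apply: eq_Rintegral => x _; rewrite dotDl dotZl.
rewrite (_ : _ \o _ = fun x => (c%:E * (dot (B x) (C x))%:E)%E); last by apply/funext.
exact: integrableZl.
Qed.

Lemma field_productDr (R : realType) (d : nat) (M : phase_mesh R d)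
    (A B C : 'rV[R]_d -> 'rV[R]_d) (c : R) :
  field M A -> field M B -> field M C ->
  field_product M C (fun x => A x + c *: B x) = field_product M C A + c * field_product M C B.
Proof. by move=> *; rewrite field_productC field_productDl// !(field_productC _ C). Qed.

Lemma field_productZr (R : realType) (d : nat) (M : phase_mesh R d)
    (A B : 'rV[R]_d -> 'rV[R]_d) (c : R) :
  field M A -> field M B ->
  field_product M A (fun x => c *: B x) = c * field_product M A B.
Proof.
move=> fA fB; rewrite /field_product -RintegralZl//; last exact: integrable_dot.
  by apply: eq_Rintegral => x _; rewrite dotZr.
exact: measurable_mesh_domain.
Qed.

Definition field_ae_eq (R : realType) (d : nat) (M : phase_mesh R d)
    (A B : 'rV[R]_d -> 'rV[R]_d) :=
  {ae lebesgue_rV d, forall x, Omega_x M x -> A x = B x}.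

Lemma field_product_ael (R : realType) (d : nat) (M : phase_mesh R d)
    (A A' B : 'rV[R]_d -> 'rV[R]_d) :
  field M A -> field M A' -> field M B -> field_ae_eq M A A' ->
  field_product M A B = field_product M A' B.
Proof.
move=> fA fA' fB e; rewrite /field_product /Rintegral; congr fine.
apply: ae_eq_integral.
- exact: measurable_mesh_domain.
- exact: measurable_int (integrable_dot fA fB).
- exact: measurable_int (integrable_dot fA' fB).
- by apply: filterS e => x + Ox => /(_ Ox) ->.
Qed.

Lemma field_product_aer (R : realType) (d : nat) (M : phase_mesh R d)
    (A A' B : 'rV[R]_d -> 'rV[R]_d) :
  field M A -> field M A' -> field M B -> field_ae_eq M A A' ->
  field_product M B A = field_product M B A'.
Proof.
move=> fA fA' fB e.
by rewrite field_productC (field_product_ael fA fA')// field_productC.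
Qed.

(** Almost everywhere equality transfers square integrability but not measurability, which for
    currents comes from Fubini. *)
Lemma field_of_ae (R : realType) (d : nat) (M : phase_mesh R d)
    (J A : 'rV[R]_d -> 'rV[R]_d) :
  (forall i, measurable_fun (Omega_x M) (fun x => J x ord0 i)) ->
  field M A -> field_ae_eq M A J -> field M J.
Proof.
move=> mJ fA e i; split => //; have [mA iA] := fA i.
apply: integrable_ae_eq iA; first exact: measurable_mesh_domain.
  by apply/measurable_EFinP; exact: measurable_funX.
by apply: filterS e => x + Ox => /(_ Ox) ->.
Qed.

(** Two readings of the update: the first shows that [J] inherits square integrability from the
    fields, the second serves as a substitution rule for [E1]. *)
Lemma field_stepP (R : realType) (d : nat) (M : phase_mesh R d) (tau : R)
    (E0 E1 J : 'rV[R]_d -> 'rV[R]_d) :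
  tau != 0 -> field_step M tau E0 E1 J ->
  field_ae_eq M (fun x => (- tau^-1) *: E1 x + tau^-1 *: E0 x) J /\
  field_ae_eq M E1 (fun x => E0 x + (- tau) *: J x).
Proof.
move=> t0 st; split; apply: filterS st => x + Ox => /(_ Ox) e.
  by apply: oppr_inj; rewrite -e; apply/rowP => i; rewrite !mxE; ring.
by rewrite scaleNr -scalerN -e scalerA divff// scale1r addrC subrK.
Qed.

Lemma fieldZ (R : realType) (d : nat) (M : phase_mesh R d)
    (A : 'rV[R]_d -> 'rV[R]_d) (c : R) :
  field M A -> field M (fun x => c *: A x).
Proof.
move=> fA; rewrite (_ : (fun x => _) = fun x => A x + (c - 1) *: A x); first exact: fieldD.
by apply/funext => x; rewrite scalerBl scale1r addrC subrK.
Qed.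

Lemma field_current (R : realType) (d : nat) (M : phase_mesh R d) (tau : R) f
    (E0 E1 : 'rV[R]_d -> 'rV[R]_d) :
  is_phase_mesh M -> square_integrable (leb2 d) (Omega M) f ->
  tau != 0 -> field M E0 -> field M E1 -> field_step M tau E0 E1 (current M f) ->
  field M (current M f).
Proof.
move=> hM sf t0 fE0 fE1 /(field_stepP t0)[e _]; apply: field_of_ae e.
  by move=> i; have [] := integrable_current i hM sf.
by apply: fieldD => //; exact: fieldZ.
Qed.

(** A difference of squares, obtained by inserting E0 - tau J for [E1] and expanding the bilinear
    product. *)
Lemma field_energy (R : realType) (d : nat) (M : phase_mesh R d) (tau : R)
    (E0 E1 J : 'rV[R]_d -> 'rV[R]_d) :
  tau != 0 -> field M E0 -> field M E1 -> field M J -> field_step M tau E0 E1 J ->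
  field_product M E1 E1 - field_product M E0 E0 =
  - (2 * tau * field_product M (field_avg E0 E1) J).
Proof.
move=> t0 fE0 fE1 fJ /(field_stepP t0)[_ e].
have fS : field M (fun x => E0 x + (- tau) *: J x) by exact: fieldD.
have -> : field_avg E0 E1 = fun x => 2^-1 *: E0 x + 2^-1 *: E1 x.
  by apply/funext => x; rewrite /field_avg /average scalerDr.
rewrite field_productDl//; last exact: fieldZ.
rewrite [field_product M (fun x => 2^-1 *: E0 x) J]field_productC field_productZr//.
rewrite (field_product_ael fE1 fS fE1 e) (field_product_aer fE1 fS fS e).
rewrite (field_product_ael fE1 fS fJ e) !field_productDl// !field_productDr//.
by rewrite (field_productC _ J); field.
Qed.

(** * Averages of two time levels *)

Lemma approximation_f_avg (R : realType) (d k : nat) (M : phase_mesh R d)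
    (f0 f1 : 'rV[R]_d * 'rV[R]_d -> R) :
  is_phase_mesh M -> Defs.approximation M k f0 -> Defs.approximation M k f1 ->
  Defs.approximation M k (f_avg f0 f1).
Proof.
move=> [mx mv _] [[sf0 p0] v0] [[sf1 p1] v1].
have mO := measurable_Omega M; split; [split|].
- rewrite (_ : f_avg f0 f1 = fun z => (0 + 2^-1 * f0 z) + 2^-1 * f1 z); last first.
    by apply/funext => z; rewrite /f_avg; ring.
  apply: square_integrableD => //; apply: square_integrableD => //.
  split; first exact: measurable_cst.
  rewrite (_ : (fun _ => _) = cst 0%E); first exact: integrable0.
  by apply/funext => z; rewrite expr0n.
- move=> K L; have [c0 h0] := p0 K L; have [c1 h1] := p1 K L.
  exists (fun a => (c0 a + c1 a) / 2) => z Kz.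
  rewrite /f_avg h0// h1// -big_split/= mulr_suml; apply: eq_bigr => a _; ring.
(* Limits add only if they exist, so the trace of the average is computed from the polynomials. *)
- move=> K L x v Kx Lv nOv.
  have [q0 [cq0 _ fq0 t0]] := polynomial_on_trace (mx.1 K) (mv.1 L) (p0 K L).
  have [q1 [cq1 _ fq1 t1]] := polynomial_on_trace (mx.1 K) (mv.1 L) (p1 K L).
  have := v0 K L x v Kx Lv nOv; have := v1 K L x v Kx Lv nOv.
  rewrite t0// t1// => e1 e0.
  rewrite (@trace_eq _ _ _ _ _ _ (fun z => (q0 z + q1 z) / 2) (x, v) (mx.1 K) (mv.1 L))//.
  + by rewrite e0 e1 addr0 mul0r.
  + by move=> z; apply: cvgMr_tmp; apply: cvgD; [exact: cq0|exact: cq1].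
  + by move=> y Ky; rewrite /f_avg fq0// fq1.
Qed.

Lemma ae_forall_ord d (T : measurableType d) (R : realType)
    (mu : {measure set T -> \bar R}) (n : nat) (P : 'I_n -> T -> Prop) :
  (forall i, {ae mu, forall x, P i x}) -> {ae mu, forall x, forall i, P i x}.
Proof.
move=> h; apply: (@negligibleS _ _ _ _ (\bigcup_(i in [set: 'I_n]) ~` [set x | P i x])).
  by move=> x /existsNP[i nP]; exists i.
by apply: negligible_fin_bigcup => i; exact: h.
Qed.

(** Additivity of the velocity integral is available where both sections are integrable, hence
    almost everywhere. *)
Lemma current_f_avg (R : realType) (d : nat) (M : phase_mesh R d)
    (f0 f1 : 'rV[R]_d * 'rV[R]_d -> R) :
  is_phase_mesh M ->
  square_integrable (leb2 d) (Omega M) f0 ->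
  square_integrable (leb2 d) (Omega M) f1 ->
  field_ae_eq M (current M (f_avg f0 f1)) (field_avg (current M f0) (current M f1)).
Proof.
move=> hM s0 s1.
suff : {ae lebesgue_rV d, forall x, forall i, Omega_x M x -> current M (f_avg f0 f1) x ord0 i =
    field_avg (current M f0) (current M f1) x ord0 i}.
  by apply: filterS => x h Ox; apply/rowP => i; exact: h.
apply: ae_forall_ord => i.
apply: filterS2 (integrable_current i hM s0).1 (integrable_current i hM s1).1.
move=> x + + Ox => /(_ Ox) i0 /(_ Ox) i1.
have mO := measurable_mesh_domain (@Tv _ _ M).
rewrite !mxE -RintegralD// -RintegralZl//.
  by apply: eq_Rintegral => v _; rewrite /f_avg; field.
rewrite (_ : _ \o _ = fun v => ((f0 (x, v) * v ord0 i)%:E + (f1 (x, v) * v ord0 i)%:E)%E).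
  exact: integrableD.
by apply/funext.
Qed.

(** * Energy conservation of the schemes *)

(** Both balances contain the work of the averaged field on the current of the same [f], with
    opposite signs. *)
Lemma energy_balance (R : realType) (d k : nat) (M : phase_mesh R d) fl
    (tau : R)
    (f0 f1 f : 'rV[R]_d * 'rV[R]_d -> R) (E0 E1 : 'rV[R]_d -> 'rV[R]_d) :
  is_phase_mesh M -> (2 <= k)%N -> tau != 0 ->
  dg_space M k f0 -> dg_space M k f1 -> Defs.approximation M k f ->
  field M E0 -> field M E1 ->
  transport_step M k fl tau f0 f1 f (field_avg E0 E1) ->
  field_step M tau E0 E1 (current M f) ->
  TE M f0 E0 = TE M f1 E1.
Proof.
move=> hM k2 t0 df0 df1 af fE0 fE1 tr st.
have fJ := field_current hM af.1.1 t0 fE0 fE1 st.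
have fA : field M (field_avg E0 E1).
  rewrite (_ : field_avg E0 E1 = fun x => 2^-1 *: E0 x + 2^-1 *: E1 x).
    by apply: fieldD => //; exact: fieldZ.
  by apply/funext => x; rewrite /field_avg /average scalerDr.
have := transport_energy hM k2 t0 df0 df1 af fA tr.
have := field_energy t0 fE0 fE1 fJ st.
by rewrite /TE => h1 h2; congr (_ / 2); lra.
Qed.

Lemma scheme1_energy (R : realType) (d k : nat) (M : phase_mesh R d) fl
    (tau : R) f0 E0 f1 E1 :
  is_phase_mesh M -> (2 <= k)%N -> tau != 0 ->
  scheme1 M k fl tau f0 E0 f1 E1 -> TE M f0 E0 = TE M f1 E1.
Proof.
move=> hM k2 t0 [fh [[[df0 _] afh [df1 _]] [fE0 fE1] _ st tr]].
exact: energy_balance tr st.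
Qed.

Lemma scheme2_energy (R : realType) (d k : nat) (M : phase_mesh R d) fl
    (tau : R) f0 E0 f1 E1 :
  is_phase_mesh M -> (2 <= k)%N -> tau != 0 ->
  scheme2 M k fl tau f0 E0 f1 E1 -> TE M f0 E0 = TE M f1 E1.
Proof.
move=> hM k2 t0 [[af0 af1] [fE0 fE1] tr st].
have af := approximation_f_avg hM af0 af1.
apply: energy_balance tr _ => //; [exact: af0.1|exact: af1.1|].
(* The scheme averages the currents, while the balance asks for the current of the average. *)
apply: filterS2 (current_f_avg hM af0.1.1 af1.1.1) st => x + + Ox.
by move=> /(_ Ox) -> /(_ Ox).
Qed.

(** Non-negativity of the two powers of 2 already gives beta1 >= 2/3, hence beta2 <= -1/3: every
    substep has nonzero length. *)
Lemma beta1_neq0 (R : realType) : @beta1 R != 0.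
Proof.
rewrite gt_eqF// /beta1.
by have := powR_ge0 (2 : R) 3^-1; have := powR_ge0 (2 : R) (- 3^-1); lra.
Qed.

Lemma beta2_neq0 (R : realType) : @beta2 R != 0.
Proof.
rewrite lt_eqF// /beta2 /beta1.
by have := powR_ge0 (2 : R) 3^-1; have := powR_ge0 (2 : R) (- 3^-1); lra.
Qed.

Lemma scheme2F_energy (R : realType) (d k : nat) (M : phase_mesh R d) fl
    (tau : R) f0 E0 f1 E1 :
  is_phase_mesh M -> (2 <= k)%N -> tau != 0 ->
  scheme2F M k fl tau f0 E0 f1 E1 -> TE M f0 E0 = TE M f1 E1.
Proof.
move=> hM k2 t0 [fa [Ea [fb [Eb [s3 s2 s1]]]]].
have b1 := beta1_neq0 R; have b2 := beta2_neq0 R.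
rewrite (scheme2_energy hM k2 _ s3) ?mulf_neq0//.
by rewrite (scheme2_energy hM k2 _ s2) ?mulf_neq0// (scheme2_energy hM k2 _ s1) ?mulf_neq0.
Qed.

(** The relation between E^(n-1/2) and E^n is the definition at the initial time; later it is the
    second half of the preceding step, solved for the intermediate field. *)
Lemma scheme3_E_before (R : realType) (d k : nat) (M : phase_mesh R d) fl
    (tau : R) f E Eh :
  is_phase_mesh M -> tau != 0 ->
  (forall n, scheme3 M k fl tau (f n) (E n) (Eh n) (f n.+1) (E n.+1)) ->
  forall n, field M (current M (f n)) /\
    field_ae_eq M (fun x => E n x + (tau / 2) *: current M (f n) x) (E_before M tau f E Eh n) /\
    field M (E_before M tau f E Eh n).
Proof.
move=> hM t0 h n; have t20 : tau / 2 != 0 by rewrite mulf_neq0// invr_eq0 pnatr_eq0.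
have fJ : field M (current M (f n)).
  have [[af0 _] [fE0 fEh _] st _ _] := h n.
  exact: field_current hM af0.1.1 t20 fE0 fEh st.
split => //; case: n fJ => [|n] fJ /=.
  have [_ [fE0 _ _] _ _ _] := h 0%N.
  by split; [exact: aeW|exact: fieldD].
have [_ [_ fEh _] _ _ /(field_stepP t20)[_ e]] := h n; split => //.
apply: filterS e => x + Ox => /(_ Ox) ->.
by rewrite scaleNr subrK.
Qed.

(** The half-step fields around time n are E^n -+ (tau/2) J^n, whose product is |E^n|^2 - (tau^2/4)
    |J^n|^2. Conservation follows by multiplying E^(n+3/2) - E^(n-1/2) = - tau (J^n + J^(n+1)) by
    E^(n+1/2), the field that drives the transport step. *)
Lemma scheme3_energy (R : realType) (d k : nat) (M : phase_mesh R d) fl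
    (tau : R) f E Eh n :
  is_phase_mesh M -> (2 <= k)%N -> tau != 0 ->
  (forall n, scheme3 M k fl tau (f n) (E n) (Eh n) (f n.+1) (E n.+1)) ->
  let TEn n := TE3 M (f n) (Eh n) (E_before M tau f E Eh n) in
  TEn n = TEn n.+1 /\
  2 * TEn n = kinetic M (f n) + field_product M (E n) (E n)
    - tau ^+ 2 / 4 * field_product M (current M (f n)) (current M (f n)).
Proof.
move=> hM k2 t0 h TEn; have t20 : tau / 2 != 0 by rewrite mulf_neq0// invr_eq0 pnatr_eq0.
have bef := scheme3_E_before hM t0 h.
have half m : field_ae_eq M (Eh m) (fun x => E m x + - (tau / 2) *: current M (f m) x).
  by have [_ _ /(field_stepP t20)[]] := h m.
have fE m : field M (E m) by have [_ []] := h m.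
have fEh m : field M (Eh m) by have [_ []] := h m.
have fJ m : field M (current M (f m)) by have [] := bef m.
have fB m : field M (E_before M tau f E Eh m) by have [_ []] := bef m.
have eB m : field_ae_eq M (E_before M tau f E Eh m)
    (fun x => E m x + (tau / 2) *: current M (f m) x).
  by have [_ [e _]] := bef m; apply: filterS e => x + Ox => /(_ Ox) ->.
have fp m : field M (fun x => E m x + (tau / 2) *: current M (f m) x) by exact: fieldD.
have fm m : field M (fun x => E m x + - (tau / 2) *: current M (f m) x) by exact: fieldD.
split; last first.
  rewrite /TEn /TE3 mulrC divfK ?pnatr_eq0// -addrA; congr (_ + _).
  rewrite (field_product_ael (fEh n) (fm n) (fB n) (half n)).
  rewrite (field_product_aer (fB n) (fp n) (fm n) (eB n)).
  rewrite field_productDl// !field_productDr// (field_productC _ (E n)).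
  by field.
have [[af0 af1] _ _ tr /(field_stepP t20)[_ e1]] := h n.
have fS : field M (fun x => Eh n x + - (tau / 2) *: current M (f n.+1) x) by exact: fieldD.
have af := approximation_f_avg hM af0 af1.
have := transport_energy hM k2 t0 af0.1 af1.1 af (fEh n) tr.
have eJ : field_ae_eq M (current M (f_avg (f n) (f n.+1)))
    (fun x => 2^-1 *: current M (f n) x + 2^-1 *: current M (f n.+1) x).
  apply: filterS (current_f_avg hM af0.1.1 af1.1.1) => x + Ox => /(_ Ox) ->.
  by rewrite /field_avg /average scalerDr.
have fJ2 : field M (fun x => 2^-1 *: current M (f n) x + 2^-1 *: current M (f n.+1) x).
  by apply: fieldD => //; exact: fieldZ.
have fJa : field M (current M (f_avg (f n) (f n.+1))).
  apply: (field_of_ae _ fJ2).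
    by move=> i; have [] := integrable_current i hM af.1.1.
  by apply: filterS eJ => x + Ox => /(_ Ox) ->.
rewrite (field_product_aer fJa fJ2 (fEh n) eJ) field_productDr ?field_productZr//;
  last exact: fieldZ.
move=> kin.
(* Pairing the four half-step updates with E^(n+1/2) gives linear relations; eliminating E^n and
   E^(n+1) from them leaves the two consecutive products and the work terms. *)
have hh := field_product_aer (fEh n) (fm n) (fEh n) (half n).
have hb := field_product_aer (fB n) (fp n) (fEh n) (eB n).
have h1 := field_product_aer (fEh n.+1) (fm n.+1) (fEh n) (half n.+1).
have h2 := field_product_aer (fE n.+1) fS (fEh n) e1.
rewrite !field_productDr// in hh hb h1 h2.
by rewrite /TEn /TE3 /= (field_productC _ (Eh n.+1)); congr (_ / 2); lra.
Qed.

Theorem theorem3p5 (R : realType) (d k : nat) (M : phase_mesh R d)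
    (fl : flux_type) (dt : R)
    (f : nat -> 'rV[R]_d * 'rV[R]_d -> R) (E : nat -> 'rV[R]_d -> 'rV[R]_d) :
  (0 < d)%N -> (2 <= k)%N -> 0 < dt -> is_phase_mesh M ->
  [/\ (forall n, scheme1 M k fl dt (f n) (E n) (f n.+1) (E n.+1)) ->
        forall n, TE M (f n) (E n) = TE M (f n.+1) (E n.+1),
      (forall n, scheme2 M k fl dt (f n) (E n) (f n.+1) (E n.+1)) ->
        forall n, TE M (f n) (E n) = TE M (f n.+1) (E n.+1),
      (forall n, scheme2F M k fl dt (f n) (E n) (f n.+1) (E n.+1)) ->
        forall n, TE M (f n) (E n) = TE M (f n.+1) (E n.+1) &
      forall Eh : nat -> 'rV[R]_d -> 'rV[R]_d,
        (forall n, scheme3 M k fl dt (f n) (E n) (Eh n) (f n.+1) (E n.+1)) ->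
        let TEn n := TE3 M (f n) (Eh n) (E_before M dt f E Eh n) in
        forall n, TEn n = TEn n.+1 /\
          2 * TEn n = kinetic M (f n) + field_product M (E n) (E n)
            - dt ^+ 2 / 4
              * field_product M (current M (f n)) (current M (f n))].
Proof.
move=> _ k2 /lt0r_neq0 t0 hM; split.
- by move=> h n; exact: scheme1_energy (h n).
- by move=> h n; exact: scheme2_energy (h n).
- by move=> h n; exact: scheme2F_energy (h n).
- move=> Eh h TEn n; exact: (scheme3_energy n hM k2 t0 h).
Qed.
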